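(* Let $K$ be a field, $E$ a directed graph and $L=L_K(E)$. The following are equivalent. (1) Every proper ideal of $L$ is semiprime. (2) Every ideal of $L$ is graded. (3) For any finite list $P_1,\dots,P_n$ of prime ideals of $L$, $P_1\cdots P_n=P_1\cap\cdots\cap P_n$. (4) The graph $E$ satisfies Condition (K).
   Context: $E=(E^0,E^1,r,s)$ is a directed graph ($E^0\ne\emptyset$, range and source maps $r,s:E^1\to E^0$, no cardinality restrictions). A path is a finite sequence $e_1\cdots e_n$ of edges with $r(e_i)=s(e_{i+1})$; it is closed if $r(e_n)=s(e_1)$, and is then based at $s(e_1)$. $E$ satisfies Condition (K) if every vertex on a closed path $\mu$ is also the base of a closed path $\gamma$ with a different set of edges from $\mu$. The Leavitt path algebra $L_K(E)$ is generated by $\{v:v\in E^0\}\cup\{e,e^*:e\in E^1\}$ with relations $vw=\delta_{v,w}v$; $s(e)e=er(e)=e$; $r(e)e^*=e^*s(e)=e^*$; $e^*f=\delta_{e,f}r(e)$; $v=\sum_{e\in s^{-1}(v)}ee^*$ when $s^{-1}(v)$ is finite and nonempty. It is $\mathbb Z$-graded with $\deg v=0$, $\deg e=1$, $\deg e^*=-1$; an ideal (two-sided) is graded if it is the direct sum of its intersections with the homogeneous components. A proper ideal $P$ is prime if $AB\subseteq P$ for ideals $A,B$ implies $A\subseteq P$ or $B\subseteq P$; a proper ideal $I$ is semiprime if $J^2\subseteq I$ for an ideal $J$ implies $J\subseteq I$. *)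

(* Defs.v *)
From HB Require Import structures.
From mathcomp Require Import all_boot all_order all_algebra.
From Stdlib Require List.
Set Implicit Arguments. Unset Strict Implicit. Unset Printing Implicit Defensive.
Import GRing.Theory.
Local Open Scope ring_scope.

(* Possibly non-unital associative K-algebras (L_K(E) is unital only when E^0
   is finite). *)
Record nalgType (K : fieldType) := NAlg {
  nsort : lmodType K;
  nmul : nsort -> nsort -> nsort;
  nmulA : forall x y z, nmul x (nmul y z) = nmul (nmul x y) z;
  nmulDl : forall x y z, nmul (x + y) z = nmul x z + nmul y z;
  nmulDr : forall x y z, nmul x (y + z) = nmul x y + nmul x z;
  nmulZl : forall (a : K) x y, nmul (a *: x) y = a *: nmul x y;
  nmulZr : forall (a : K) x y, nmul x (a *: y) = a *: nmul x y }.

Section Leavitt.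
Variables (K : fieldType) (E0 E1 : Type) (r s : E1 -> E0).

Definition leavitt_family (B : nalgType K)
    (v : E0 -> nsort B) (e es : E1 -> nsort B) : Prop :=
  let m := @nmul K B in
 (forall w, m (v w) (v w) = v w) /\
 (forall w w', w <> w' -> m (v w) (v w') = 0) /\
 (forall f, m (v (s f)) (e f) = e f /\ m (e f) (v (r f)) = e f) /\
 (forall f, m (v (r f)) (es f) = es f /\ m (es f) (v (s f)) = es f) /\
 (forall f, m (es f) (e f) = v (r f)) /\
 (forall f g, f <> g -> m (es f) (e g) = 0) /\
    (* Cuntz-Krieger relation at vertices w with s^{-1}(w) finite, nonempty:
         l is a duplicate-free enumeration of s^{-1}(w) *)
      (forall w (l : seq E1), l <> [::] -> List.NoDup l ->
          (forall f, List.In f l <-> s f = w) ->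
          v w = \sum_(f <- l) m (e f) (es f)).

Definition nalg_hom (A B : nalgType K) (phi : nsort A -> nsort B) : Prop :=
  [/\ forall x y, phi (x + y) = phi x + phi y,
      forall (a : K) x, phi (a *: x) = a *: phi x
    & forall x y, phi (@nmul K A x y) = @nmul K B (phi x) (phi y)].

Definition is_leavitt_path_algebra (A : nalgType K)
    (v : E0 -> nsort A) (e es : E1 -> nsort A) : Prop :=
  leavitt_family v e es /\
  forall (B : nalgType K) (vB : E0 -> nsort B) (eB esB : E1 -> nsort B),
    leavitt_family vB eB esB ->
    (exists phi, nalg_hom phi /\
        (forall w, phi (v w) = vB w) /\ (forall f, phi (e f) = eB f)
        /\ (forall f, phi (es f) = esB f)) /\
    (forall phi psi : nsort A -> nsort B, nalg_hom phi -> nalg_hom psi ->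
        (forall w, phi (v w) = psi (v w)) -> (forall f, phi (e f) = psi (e f))
        -> (forall f, phi (es f) = psi (es f)) -> forall x, phi x = psi x).

Inductive lgen := GV of E0 | GE of E1 | GS of E1.
Definition gdeg (g : lgen) : int :=
  match g with GV _ => 0 | GE _ => 1 | GS _ => -1 end.

Section Grading.
Variables (A : nalgType K) (v : E0 -> nsort A) (e es : E1 -> nsort A).
Definition gval (g : lgen) : nsort A :=
  match g with GV w => v w | GE f => e f | GS f => es f end.
(* nonempty words g :: w in the generators *)
Definition weval (gw : lgen * seq lgen) : nsort A :=
  foldl (fun x h => @nmul K A x (gval h)) (gval gw.1) gw.2.
Definition wdeg (gw : lgen * seq lgen) : int :=
  gdeg gw.1 + \sum_(h <- gw.2) gdeg h.
Definition LPhomog (n : int) (x : nsort A) : Prop :=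
  exists l : seq (K * (lgen * seq lgen)),
    (forall p, List.In p l -> wdeg p.2 = n) /\ x = \sum_(p <- l) p.1 *: weval p.2.
End Grading.
End Leavitt.

Section Ideals.
Variables (K : fieldType) (A : nalgType K).
Local Notation T := (nsort A).
Local Notation m := (@nmul K A).

Definition LPideal (I : T -> Prop) : Prop :=
  [/\ I 0, (forall x y, I x -> I y -> I (x + y)), (forall x, I x -> I (- x)),
      (forall a x, I x -> I (m a x)) & (forall a x, I x -> I (m x a))].

Definition LPsub (I J : T -> Prop) : Prop := forall x, I x -> J x.
Definition LPeq (I J : T -> Prop) : Prop := forall x, I x <-> J x.
Definition LPproper (I : T -> Prop) : Prop := exists x, ~ I x.

Definition LPprod (I J : T -> Prop) : T -> Prop := fun x =>
  exists l : seq (T * T), (forall p, List.In p l -> I p.1 /\ J p.2) /\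
    x = \sum_(p <- l) m p.1 p.2.

Definition LPprime (P : T -> Prop) : Prop :=
  [/\ LPideal P, LPproper P &
      forall I J, LPideal I -> LPideal J -> LPsub (LPprod I J) P ->
        LPsub I P \/ LPsub J P].

Definition LPsemiprime (P : T -> Prop) : Prop :=
  [/\ LPideal P, LPproper P &
      forall J, LPideal J -> LPsub (LPprod J J) P -> LPsub J P].

Definition LPprod_list (P1 : T -> Prop) (ps : seq (T -> Prop)) : T -> Prop :=
  foldl LPprod P1 ps.
Definition LPcap_list (P1 : T -> Prop) (ps : seq (T -> Prop)) : T -> Prop :=
  fun x => forall P, List.In P (P1 :: ps) -> P x.

Definition LPgraded (E0 E1 : Type) (v : E0 -> T) (e es : E1 -> T)
    (I : T -> Prop) : Prop :=
  forall x, I x -> exists l : seq (int * T),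
    (forall p, List.In p l -> I p.2 /\ LPhomog v e es p.1 p.2) /\
    x = \sum_(p <- l) p.2.
End Ideals.

Section Graph.
Variables (E0 E1 : Type) (r s : E1 -> E0).
Fixpoint LPpath (e : E1) (l : seq E1) : Prop :=
  match l with [::] => True | f :: l' => r e = s f /\ LPpath f l' end.
Definition LPclosed_path (e : E1) (l : seq E1) : Prop :=
  LPpath e l /\ r (last e l) = s e.
Definition LPcondition_K : Prop :=
  forall e l, LPclosed_path e l ->
  forall w, (exists f, List.In f (e :: l) /\ s f = w) ->
  exists e' l', [/\ LPclosed_path e' l', s e' = w &
     ~ (forall g, List.In g (e :: l) <-> List.In g (e' :: l'))].
End Graph.

(* Main.v *)
Require Import Defs.
From HB Require Import structures.
From mathcomp Require Import all_boot all_order all_algebra.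
From mathcomp Require Import zify.
From mathcomp Require Import boolp functions.
From Stdlib Require List.
Set Implicit Arguments. Unset Strict Implicit. Unset Printing Implicit Defensive.
Import GRing.Theory.
Local Open Scope ring_scope.

(** Call u - sum_(f in F) f f^*, for F a finite set of edges issuing from u, a
gap. Under Condition (K) every ideal I is generated by the gaps it contains.
Indeed an element of I reduces, modulo such gaps, to a combination of real
paths; stripping a shortest path from it leaves k u + (closed paths at u) with
k <> 0. Two closed paths a, b at u with different edge sets do not commute as
words, so for each closed path g one of rho = ab, ba is not an initial segment
of g g g ...; then rho^* g rho = 0, and conjugation by such rho removes the
closed paths one by one until u itself is in I. Since gaps are homogeneous
idempotents, every ideal is graded and idempotent, which gives (1), (2), (3).

If (K) fails, some vertex w carries a single cycle c, and w is the source of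
only one infinite path in the shift-equivalence class of z = c c c .... L acts
on functions on this class with values in any module, with edges weighted by
invertible operators. With trivial weights the kernel P is a prime ideal
containing c - w. Over the dual numbers, giving the first edge of c the weight
1 + eps, the kernel Q contains P^2 but not c - w, which refutes (1) and (3).
Weighting every edge by the shift of K^Z shows that homogeneous elements of P
kill the twisted module, which c - w does not: P is not graded. *)

(** * Subalgebras and endomorphism algebras *)

Definition linclosed (K : fieldType) (V : lmodType K) (S : V -> Prop) : Prop :=
  S 0 /\ forall (a : K) x y, S x -> S y -> S (a *: x + y).

Section Submodule.
Variables (K : fieldType) (V : lmodType K) (S : V -> Prop) (clS : linclosed S).

(** The closure proof is a parameter of the predicate, so that the submodule instance can be
    attached to the predicate alone. *)
Definition submodPred of linclosed S : {pred V} := fun x => `[< S x >].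

Fact submodPred_closed : submod_closed (submodPred clS).
Proof.
case: (clS) => S0 SD; split => [|a x y /asboolP Sx /asboolP Sy]; apply/asboolP => //.
exact: SD.
Qed.
HB.instance Definition _ :=
  GRing.isSubmodClosed.Build K V (submodPred clS) submodPred_closed.

Record submodule := Submodule { subval : V; _ : subval \in submodPred clS }.
HB.instance Definition _ := [isSub for subval].
HB.instance Definition _ := [Choice of submodule by <:].
HB.instance Definition _ := [SubChoice_isSubLmodule of submodule by <:].

Lemma subvalP (x : submodule) : S (subval x).
Proof. exact/asboolP/(valP x). Qed.

Lemma subval_sum (I : Type) (l : seq I) (F : I -> submodule) :
  subval (\sum_(i <- l) F i) = \sum_(i <- l) subval (F i).
Proof. by apply: (big_morph subval). Qed.

Definition insubmod x (Sx : S x) : submodule :=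
  Submodule (introT (asboolP _) Sx : x \in submodPred clS).

End Submodule.

Section SubAlgebra.
Variables (K : fieldType) (A : nalgType K) (S : nsort A -> Prop).
Hypotheses (clS : linclosed S) (Smul : forall x y, S x -> S y -> S (nmul x y)).

Definition subalg_mul (x y : submodule clS) : submodule clS :=
  insubmod clS (Smul (subvalP x) (subvalP y)).

Definition subalg : nalgType K.
Proof.
by refine (@NAlg K (submodule clS) subalg_mul _ _ _ _ _);
  move=> *; apply: val_inj;
  rewrite ?(nmulA, nmulDl, nmulDr, nmulZl, nmulZr) //=
    ?(nmulA, nmulDl, nmulDr, nmulZl, nmulZr).
Defined.

End SubAlgebra.

Lemma linear_at0 (K : fieldType) (V W : lmodType K) (f : V -> W) : linear f -> f 0 = 0.
Proof. by move=> lf; have := lf (-1) 0 0; rewrite scaler0 addr0 scaleN1r addNr. Qed.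

Section EndAlgebra.
Variables (K : fieldType) (V : lmodType K).

Fact linear_linclosed : linclosed (fun f : V -> V => linear f).
Proof.
split=> [a x y|k f g lf lg a x y]; first by rewrite scaler0 addr0.
rewrite !fctE lf lg !scalerDr !scalerA mulrC -!addrA; congr (_ + _).
by rewrite addrCA.
Qed.

(** Cutting the endomorphisms out of the space of all functions supplies the module structure and
    lets equalities be checked on values. *)
Definition endmod := submodule linear_linclosed.

Fact comp_linear (f g : V -> V) : linear f -> linear g -> linear (f \o g).
Proof. by move=> lf lg a x y; rewrite /= lg lf. Qed.

Definition end_mul (f g : endmod) : endmod :=
  insubmod linear_linclosed (comp_linear (subvalP f) (subvalP g)).

Definition endalg : nalgType K.
Proof.
refine (@NAlg K endmod end_mul _ _ _ _ _).
- by move=> x y z; apply: val_inj.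
- by move=> x y z; apply: val_inj.
- move=> x y z; apply: val_inj; apply/funext => u /=; rewrite !fctE.
  by have := subvalP x 1 (subval y u) (subval z u); rewrite !scale1r.
- by move=> a x y; apply: val_inj.
- move=> a x y; apply: val_inj; apply/funext => u /=; rewrite !fctE.
  by have := subvalP x a (subval y u) 0; rewrite (linear_at0 (subvalP x)) !addr0.
Defined.

End EndAlgebra.

(** * Generation *)

Section MulTheory.
Variables (K : fieldType) (A : nalgType K).
Local Notation "x ** y" := (@nmul K A x y) (at level 40, left associativity).
Implicit Types x y z : nsort A.

Lemma nmul0l x : 0 ** x = 0.
Proof. by have := nmulZl 0 0 x; rewrite !scale0r. Qed.
Lemma nmul0r x : x ** 0 = 0.
Proof. by have := nmulZr 0 x 0; rewrite !scale0r. Qed.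
Lemma nmulNl x y : (- x) ** y = - (x ** y).
Proof. by rewrite -scaleN1r nmulZl scaleN1r. Qed.
Lemma nmulNr x y : x ** (- y) = - (x ** y).
Proof. by rewrite -scaleN1r nmulZr scaleN1r. Qed.
Lemma nmulBl x y z : (x - y) ** z = x ** z - y ** z.
Proof. by rewrite nmulDl nmulNl. Qed.
Lemma nmulBr x y z : x ** (y - z) = x ** y - x ** z.
Proof. by rewrite nmulDr nmulNr. Qed.
Lemma nmul_suml (I : Type) (l : seq I) (F : I -> nsort A) x :
  (\sum_(i <- l) F i) ** x = \sum_(i <- l) (F i ** x).
Proof.
by apply: (big_morph (fun z => z ** x)) => [y z|]; rewrite ?nmulDl ?nmul0l.
Qed.
Lemma nmul_sumr (I : Type) (l : seq I) (F : I -> nsort A) x :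
  x ** (\sum_(i <- l) F i) = \sum_(i <- l) (x ** F i).
Proof.
by apply: (big_morph (nmul x)) => [y z|]; rewrite ?nmulDr ?nmul0r.
Qed.

Inductive lin_span (G : nsort A -> Prop) : nsort A -> Prop :=
| lin_span0 : lin_span G 0
| lin_spanC a g x : G g -> lin_span G x -> lin_span G (a *: g + x).

Lemma lin_span_linclosed G : linclosed (lin_span G).
Proof.
split=> [|a x y Gx Gy]; first exact: lin_span0.
elim: Gx => [|b g x' Gg _ IH]; first by rewrite scaler0 add0r.
by rewrite scalerDr scalerA -addrA; apply: lin_spanC.
Qed.

Lemma lin_span_gen (G : nsort A -> Prop) g : G g -> lin_span G g.
Proof. by move=> Gg; rewrite -[g]addr0 -[g]scale1r; apply/lin_spanC/lin_span0. Qed.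

Lemma lin_span_sub (G S : nsort A -> Prop) :
  linclosed S -> (forall g, G g -> S g) -> forall x, lin_span G x -> S x.
Proof.
move=> [S0 SD] GS x; elim=> [//|a g y /GS Sg _ Sy]; exact: SD.
Qed.

Lemma linclosedD (S : nsort A -> Prop) x y : linclosed S -> S x -> S y -> S (x + y).
Proof. by case=> _ SD Sx Sy; rewrite -[x]scale1r; apply: SD. Qed.
Lemma linclosedZ (S : nsort A -> Prop) a x : linclosed S -> S x -> S (a *: x).
Proof. by case=> S0 SD Sx; rewrite -[_ *: _]addr0; apply: SD. Qed.
Lemma linclosedN (S : nsort A -> Prop) x : linclosed S -> S x -> S (- x).
Proof. by move=> clS Sx; rewrite -scaleN1r; apply: linclosedZ. Qed.

End MulTheory.
Arguments lin_span_gen {K A G g}.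

Lemma nmul_subr_linclosed (K : fieldType) (A : nalgType K) (S : nsort A -> Prop) a :
  linclosed S -> linclosed (fun x => S (nmul a x)).
Proof.
move=> [S0 SD]; split=> [|k x y Sx Sy]; first by rewrite nmul0r.
by rewrite nmulDr nmulZr; apply: SD.
Qed.
Lemma nmul_subl_linclosed (K : fieldType) (A : nalgType K) (S : nsort A -> Prop) a :
  linclosed S -> linclosed (fun x => S (nmul x a)).
Proof.
move=> [S0 SD]; split=> [|k x y Sx Sy]; first by rewrite nmul0l.
by rewrite nmulDl nmulZl; apply: SD.
Qed.

Lemma InE (T : eqType) (x : T) (l : seq T) : List.In x l <-> x \in l.
Proof.
elim: l => //= y l IH; rewrite inE; split.
  by case=> [->|/IH ->]; rewrite ?eqxx ?orbT.
by move=> /orP[/eqP ->|/IH]; auto.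
Qed.
Lemma NoDupE (T : eqType) (l : seq T) : List.NoDup l <-> uniq l.
Proof.
elim: l => [|y l IH] /=; first by split=> // _; apply: List.NoDup_nil.
split=> [h|/andP[yl /IH ul]].
  inversion_clear h as [|? ? yl ul].
  by apply/andP; split; [apply/negP => /InE | apply/IH].
by apply: List.NoDup_cons => // /InE; apply/negP.
Qed.

Section Generation.
Variables (K : fieldType) (E0 E1 : Type) (r s : E1 -> E0) (L : nalgType K).
Variables (v : E0 -> nsort L) (e es : E1 -> nsort L).
Hypothesis HL : is_leavitt_path_algebra r s v e es.

(* The subalgebra S receives a homomorphism from L by universality, and its
   composite with the inclusion S -> L is the identity. *)
Lemma leavitt_ind (S : nsort L -> Prop) :
  linclosed S -> (forall x y, S x -> S y -> S (nmul x y)) ->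
  (forall w, S (v w)) -> (forall f, S (e f)) -> (forall f, S (es f)) ->
  forall x, S x.
Proof.
move=> clS Smul Sv Se Ses x.
have [[Hv [Hvv [He [Hs [Hee [Hef HCK]]]]]] HU] := HL.
pose B := subalg clS Smul.
pose vB w : nsort B := insubmod clS (Sv w).
pose eB f : nsort B := insubmod clS (Se f).
pose sB f : nsort B := insubmod clS (Ses f).
have fam : leavitt_family r s vB eB sB.
  split; first by move=> w; apply: val_inj; apply: Hv.
  split; first by move=> w w' ww'; apply: val_inj; apply: Hvv.
  split; first by move=> f; split; apply: val_inj; have [] := He f.
  split; first by move=> f; split; apply: val_inj; have [] := Hs f.
  split; first by move=> f; apply: val_inj; apply: Hee.
  split; first by move=> f g fg; apply: val_inj; apply: Hef.
  move=> w l l0 nd lw; apply: val_inj => /=.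
  by rewrite subval_sum; apply: HCK.
have [[phi [[phiD phiZ phiM] [phiv [phie phis]]]] _] := HU _ _ _ _ fam.
have [_ uniqL] := HU L v e es (proj1 HL).
suff <- : subval (phi x) = x by apply: subvalP.
apply: (uniqL (fun x => subval (phi x)) id) => //.
- split=> [y z|a y|y z]; by rewrite ?(phiD, phiZ, phiM).
- by move=> w; rewrite phiv.
- by move=> f; rewrite phie.
- by move=> f; rewrite phis.
Qed.

(** The elements of M whose right multiplication preserves M form a subalgebra containing the
    generators, so [leavitt_ind] applies to them. *)
Lemma leavitt_ind_right (M : nsort L -> Prop) :
  linclosed M ->
  (forall w, M (v w)) -> (forall f, M (e f)) -> (forall f, M (es f)) ->
  (forall x w, M x -> M (nmul x (v w))) -> (forall x f, M x -> M (nmul x (e f))) ->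
  (forall x f, M x -> M (nmul x (es f))) -> forall x, M x.
Proof.
move=> clM Mv Me Ms Mxv Mxe Mxs x.
pose S x := M x /\ forall y, M y -> M (nmul y x).
suff [] : S x by [].
move: x; apply: leavitt_ind => [|x y [Mx Mxx] [My Myy]|w|f|f]; last 3 first.
- by split=> // y; apply: Mxv.
- by split=> // y; apply: Mxe.
- by split=> // y; apply: Mxs.
- split=> [|a x y [Mx Mxx] [My Myy]].
    by case: (clM) => M0 _; split=> // y _; rewrite nmul0r.
  split=> [|z Mz]; first by apply: (proj2 clM).
  by rewrite nmulDr nmulZr; apply: (proj2 clM); auto.
- by split=> [|z Mz]; [apply: Myy | rewrite nmulA; apply/Myy/Mxx].
Qed.

Lemma words_span x :
  lin_span (fun y => exists gw, y = weval v e es gw) x.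
Proof.
set G := fun y => _; have clG := lin_span_linclosed G.
have rc gw g : weval v e es (gw.1, rcons gw.2 g)
               = nmul (weval v e es gw) (gval v e es g).
  by rewrite /weval /= foldl_rcons.
have step y g : lin_span G y -> lin_span G (nmul y (gval v e es g)).
  move=> Gy; pose S z := lin_span G (nmul z (gval v e es g)).
  apply: (@lin_span_sub _ _ G S) Gy; first exact: nmul_subl_linclosed.
  by move=> _ [gw ->]; apply: lin_span_gen; exists (gw.1, rcons gw.2 g).
move: x; apply: leavitt_ind_right => //.
- by move=> w; apply: lin_span_gen; exists (GV _ w, [::]).
- by move=> f; apply: lin_span_gen; exists (GE _ f, [::]).
- by move=> f; apply: lin_span_gen; exists (GS _ f, [::]).
- by move=> x w Sx; apply: (step x (GV _ w)).
- by move=> x f Sx; apply: (step x (GE _ f)).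
- by move=> x f Sx; apply: (step x (GS _ f)).
Qed.

End Generation.

(** * Reduction of ideals under Condition (K) *)

Section Words.
Local Open Scope nat_scope.

(** Euclidean descent on the total length: if a is the shorter word then b = a c, and cancelling a
    leaves a c = c a, a smaller instance. *)
Lemma commuting_words_mem (T : eqType) (a b : seq T) :
  a != [::] -> b != [::] -> a ++ b = b ++ a -> a =i b.
Proof.
have [n] := ubnP (size a + size b); elim: n a b => // n IH a b.
wlog ab : a b / size a <= size b => [W lt_n a0 b0 eqab|].
  have [ab|/ltnW ba] := leqP (size a) (size b); first exact: W.
  by move=> x; rewrite (W b a) // addnC.
move=> lt_n a0 b0 eqab; have/prefixP[c eb] : prefix a b.
  have := congr1 (take (size a)) eqab; rewrite take_size_cat // takel_cat // => ->.
  exact: prefix_take.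
move: eqab ab lt_n b0; rewrite {b}eb -catA => /(congr1 (drop (size a))).
rewrite !drop_size_cat // size_cat => eqac _ lt_n _.
have [->|c0] := eqVneq c [::]; first by rewrite cats0.
move=> x; rewrite mem_cat (IH a c) ?orbb //.
by case: (a) a0 lt_n => //= y a' _; lia.
Qed.

(** An initial segment a of g a is an initial segment of g g g ..., so its letters are determined by
    g; they are read off by strong induction on the position. *)
Lemma prefix_shift_inj (T : eqType) (g a b : seq T) :
  g != [::] -> size a = size b -> prefix a (g ++ a) -> prefix b (g ++ b) -> a = b.
Proof.
move=> g0 sab /prefixP[a' ea] /prefixP[b' eb].
have step c c' i x0 : g ++ c = c ++ c' -> i < size c ->
    nth x0 c i = if i < size g then nth x0 g i else nth x0 c (i - size g).
  by move=> ec ic; have := congr1 (nth x0 ^~ i) ec; rewrite !nth_cat ic => <-.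
case: g g0 ea eb step => // x0 g _ ea eb step.
apply: (@eq_from_nth _ x0) => // i; have [n] := ubnP i; elim: n i => // n IH i.
rewrite ltnS => le_in ia; rewrite (step _ _ _ _ ea) // (step _ _ _ _ eb) -?sab //.
case: ltnP => // gi; apply: IH; last exact: leq_ltn_trans (leq_subr _ _) ia.
by move: gi => /=; lia.
Qed.

End Words.

(** * Arithmetic of paths and local units *)

Section Reduction.
Variables (K : fieldType) (E0 E1 : eqType) (r s : E1 -> E0) (L : nalgType K).
Variables (v : E0 -> nsort L) (e es : E1 -> nsort L).
Hypothesis HL : is_leavitt_path_algebra r s v e es.
Local Notation "x ** y" := (@nmul K L x y) (at level 40, left associativity).

Let Hfam := proj1 HL.

Lemma mul_vv w w' : v w ** v w' = if w == w' then v w else 0.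
Proof.
case: Hfam => Hv [Hvv _]; by case: eqP => [->|/Hvv].
Qed.
Lemma mul_vse f : v (s f) ** e f = e f.
Proof. by case: Hfam => _ [_ [He _]]; case: (He f). Qed.
Lemma mul_evr f : e f ** v (r f) = e f.
Proof. by case: Hfam => _ [_ [He _]]; case: (He f). Qed.
Lemma mul_vres f : v (r f) ** es f = es f.
Proof. by case: Hfam => _ [_ [_ [Hs _]]]; case: (Hs f). Qed.
Lemma mul_esvs f : es f ** v (s f) = es f.
Proof. by case: Hfam => _ [_ [_ [Hs _]]]; case: (Hs f). Qed.
Lemma mul_ese f g : es f ** e g = if f == g then v (r f) else 0.
Proof.
case: Hfam => _ [_ [_ [_ [Hse [Hsf _]]]]]; by case: eqP => [->|/Hsf].
Qed.
Lemma mul_ve w f : v w ** e f = if w == s f then e f else 0.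
Proof.
rewrite -[in LHS]mul_vse nmulA mul_vv; case: eqP => [->|_]; last exact: nmul0l.
exact: mul_vse.
Qed.
Lemma mul_esv f w : es f ** v w = if w == s f then es f else 0.
Proof.
rewrite -[in LHS]mul_esvs -nmulA mul_vv eq_sym.
by case: eqP => _; [apply: mul_esvs | apply: nmul0r].
Qed.

(* A path is coded by its list of edges together with its range u; lists of
   edges that do not compose get the value 0 in L. *)
Definition psrc (l : seq E1) (u : E0) : E0 := if l is f :: _ then s f else u.
Fixpoint pchain (l : seq E1) (u : E0) : bool :=
  if l is f :: l' then (r f == psrc l' u) && pchain l' u else true.
Definition pe (l : seq E1) (u : E0) := foldr (fun f x => e f ** x) (v u) l.
Definition ps (l : seq E1) (u : E0) := foldr (fun f x => x ** es f) (v u) l.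

Lemma mul_vpe w l u : v w ** pe l u = if w == psrc l u then pe l u else 0.
Proof.
case: l => [|f l] /=; first by rewrite mul_vv; case: eqP => [->|].
by rewrite nmulA mul_ve; case: eqP => // _; rewrite nmul0l.
Qed.
Lemma mul_psv l u w : ps l u ** v w = if w == psrc l u then ps l u else 0.
Proof.
case: l => [|f l] /=; first by rewrite mul_vv eq_sym.
by rewrite -nmulA mul_esv; case: eqP => // _; rewrite nmul0r.
Qed.
Lemma pe_v l u : pe l u ** v u = pe l u.
Proof. by elim: l => [|f l IH] /=; rewrite ?mul_vv ?eqxx // -nmulA IH. Qed.
Lemma pe_nchain l u : ~~ pchain l u -> pe l u = 0.
Proof.
elim: l => //= f l IH; rewrite negb_and => /orP[rf|/IH ->]; last exact: nmul0r.
by rewrite -mul_evr -nmulA mul_vpe (negPf rf) nmul0r.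
Qed.
Lemma pe_cat a b u : pe (a ++ b) u = pe a (psrc b u) ** pe b u.
Proof.
by elim: a => [|f a IH] /=; rewrite ?mul_vpe ?eqxx // IH nmulA.
Qed.
Lemma pe1 f : pe [:: f] (r f) = e f.
Proof. exact: mul_evr. Qed.
Lemma pe_rcons l f : pe (rcons l f) (r f) = pe l (s f) ** e f.
Proof. by rewrite -cats1 pe_cat pe1. Qed.

(** Ghost edges cancel real edges one at a time, so a must be an initial segment of l. The test on
    the source covers an empty a and lists l that do not compose. *)
Lemma mul_ps_pe a l u : pchain a u -> (size a <= size l)%N ->
  ps a u ** pe l u = if prefix a l && (psrc (drop (size a) l) u == u)
                     then pe (drop (size a) l) u else 0.
Proof.
elim: a l => [|f a IH] l /=; first by rewrite drop0 mul_vpe prefix0s eq_sym.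
case: l => //= g l /andP[/eqP rf ca] sal; rewrite -nmulA [es f ** _]nmulA mul_ese.
case: eqP => _; last by rewrite nmul0l nmul0r.
by rewrite nmulA mul_psv rf eqxx IH.
Qed.

Lemma ps_pe a u : pchain a u -> ps a u ** pe a u = v u.
Proof.
by move=> ca; rewrite mul_ps_pe // prefix_refl drop_size /= eqxx.
Qed.

(** The span is stable under right multiplication by generators: a ghost edge lengthens b, while an
    edge cancels the rightmost ghost edge or, when b is empty, lengthens a. *)
Lemma normal_span x :
  lin_span (fun y => exists a b z, y = pe a z ** ps b z) x.
Proof.
set G := fun y => _; have clG := lin_span_linclosed G.
have G0 : lin_span G 0 by apply: lin_span0.
have step y0 : (forall a b z, lin_span G (pe a z ** ps b z ** y0)) ->
    forall y, lin_span G y -> lin_span G (y ** y0).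
  move=> h y; apply: (@lin_span_sub _ _ G (fun y => lin_span G (y ** y0))).
    exact: nmul_subl_linclosed.
  by move=> _ [a [b [z ->]]].
move: x; apply: (leavitt_ind_right HL) => //.
- by move=> w; apply: lin_span_gen; exists [::], [::], w; rewrite /= mul_vv eqxx.
- by move=> f; apply: lin_span_gen; exists [:: f], [::], (r f); rewrite pe1 mul_evr.
- by move=> f; apply: lin_span_gen; exists [::], [:: f], (r f); rewrite /= !mul_vres.
- move=> x w; apply: step => a b z; rewrite -nmulA mul_psv.
  by case: eqP => _; rewrite ?nmul0r //; apply: lin_span_gen; exists a, b, z.
- move=> x f; apply: step => a [|g b] z; rewrite -nmulA /=.
    rewrite mul_ve; case: eqP => [->|_]; rewrite ?nmul0r // -pe_rcons.
    by apply: lin_span_gen; exists (rcons a f), [::], (r f); rewrite pe_v.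
  rewrite -nmulA mul_ese; case: eqP => [->|_]; rewrite ?nmul0r //.
  rewrite mul_psv; case: eqP => [_|_]; rewrite ?nmul0r //.
  by apply: lin_span_gen; exists a, b, z.
- move=> x f; apply: step => a b z; rewrite -nmulA.
  by apply: lin_span_gen; exists a, (f :: b), z.
Qed.

Lemma mul_sumv_v U w :
  uniq U -> (\sum_(u <- U) v u) ** v w = if w \in U then v w else 0.
Proof.
elim: U => [|u U IH] /=; first by rewrite big_nil nmul0l.
move=> /andP[uU /IH {}IH]; rewrite big_cons nmulDl IH mul_vv inE eq_sym.
case: eqP => [->|_]; last by rewrite add0r.
by rewrite (negPf uU) addr0.
Qed.

(** Local units: the vertices in U are the sources of the ghost factors b of the terms of x. *)
Lemma right_unit x : exists U, uniq U /\ x ** (\sum_(u <- U) v u) = x.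
Proof.
have := normal_span x; elim=> [|k _ y [a [b [z ->]]] _ [U [uU eU]]].
  by exists [::]; rewrite nmul0l.
have sub w y' : uniq (undup (w :: U)) -> y' ** v w = y' ->
    y' ** (\sum_(u <- undup (w :: U)) v u) = y'.
  move=> uU' <-; rewrite -nmulA; congr (_ ** _).
  rewrite nmul_sumr -[RHS](_ : (\sum_(u <- undup (w :: U)) v u) ** v w = _).
    rewrite nmul_suml; apply: eq_bigr => u _; rewrite !mul_vv eq_sym.
    by case: eqP => // ->.
  by rewrite mul_sumv_v // mem_undup mem_head.
exists (undup (psrc b z :: U)); split; first exact: undup_uniq.
rewrite nmulDl nmulZl sub ?undup_uniq //; last by rewrite -nmulA mul_psv eqxx.
(* Since y is y times the old sum of vertices, it suffices that the old sum times the enlarged one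
   is the old sum. *)
congr (_ + _); rewrite -{1}eU -nmulA nmul_suml.
rewrite -[RHS]eU; congr (_ ** _); apply: eq_big_seq => u uu.
rewrite nmul_sumr -[RHS](_ : (\sum_(w <- undup (psrc b z :: U)) v w) ** v u = _).
  rewrite nmul_suml; apply: eq_bigr => w _; rewrite !mul_vv eq_sym.
  by case: eqP => // ->.
by rewrite mul_sumv_v ?undup_uniq // mem_undup inE uu orbT.
Qed.

Section Ideal.
Variable I : nsort L -> Prop.
Hypothesis idI : LPideal I.

(** Closure under scalars comes from a local unit: if x U = x then k x = x (k U). *)
Lemma ideal_linclosed : linclosed I.
Proof.
case: idI => I0 ID _ _ Ir; split=> // k x y Ix Iy; apply: ID => //.
have [U [_ <-]] := right_unit x.
by rewrite -nmulZr; apply: Ir.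
Qed.
Local Notation clI := ideal_linclosed.
Lemma ideal_mull a x : I x -> I (a ** x).
Proof. by case: idI => _ _ _ h _; apply: h. Qed.
Lemma ideal_mulr a x : I x -> I (x ** a).
Proof. by case: idI => _ _ _ _ h; apply: h. Qed.

End Ideal.

(** * Gaps and the ideal they generate *)

Definition emission (F : seq E1) := \sum_(f <- F) e f ** es f.
Definition gap u (F : seq E1) := v u - emission F.
Definition emitted u (F : seq E1) := uniq F && all (fun f => s f == u) F.

Lemma mul_emission_e F f : uniq F -> emission F ** e f = if f \in F then e f else 0.
Proof.
elim: F => [|g F IH] /=; first by rewrite /emission big_nil nmul0l.
move=> /andP[gF /IH]; rewrite /emission big_cons nmulDl => ->.
rewrite -nmulA mul_ese inE eq_sym; case: eqP => [->|_]; last by rewrite nmul0r add0r.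
by rewrite (negPf gF) mul_evr addr0.
Qed.
Lemma mul_es_emission F f : uniq F -> es f ** emission F = if f \in F then es f else 0.
Proof.
elim: F => [|g F IH] /=; first by rewrite /emission big_nil nmul0r.
move=> /andP[gF /IH]; rewrite /emission big_cons nmulDr => ->.
rewrite nmulA mul_ese inE; case: eqP => [->|_]; last by rewrite nmul0l add0r.
by rewrite (negPf gF) mul_vres addr0.
Qed.
Lemma emission_mul F F' : uniq F' -> {subset F <= F'} ->
  emission F ** emission F' = emission F /\ emission F' ** emission F = emission F.
Proof.
move=> uF' FF'; rewrite [emission F]/emission; split.
  rewrite nmul_suml; apply: eq_big_seq => f /FF' fF.
  by rewrite -nmulA mul_es_emission // fF.
rewrite nmul_sumr; apply: eq_big_seq => f /FF' fF.
by rewrite nmulA mul_emission_e // fF.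
Qed.
Lemma emission_v u F : emitted u F ->
  v u ** emission F = emission F /\ emission F ** v u = emission F.
Proof.
case/andP => _ /allP sF; rewrite /emission nmul_sumr nmul_suml.
split; apply: eq_big_seq => f /sF /eqP <-.
  by rewrite nmulA mul_vse.
by rewrite -nmulA mul_esvs.
Qed.
(** As F grows, the idempotent [emission F] grows and the gap shrinks. *)
Lemma gap_mul u F F' : emitted u F -> emitted u F' -> {subset F <= F'} ->
  gap u F' ** gap u F = gap u F'.
Proof.
move=> sF sF' FF'; have [_ uF'] := emission_v sF'; have [uF _] := emission_v sF.
have [_ F'F] := emission_mul (proj1 (andP sF')) FF'.
rewrite /gap nmulBl !nmulBr F'F uF uF' mul_vv eqxx.
by rewrite opprB addrA subrK.
Qed.
Lemma gap_idem u F : emitted u F -> gap u F ** gap u F = gap u F.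
Proof. by move=> sF; apply: gap_mul. Qed.
Lemma mul_gap_e u F f : emitted u F ->
  gap u F ** e f = if (s f == u) && (f \notin F) then e f else 0.
Proof.
move=> /andP[uF /allP sF]; rewrite nmulBl mul_ve mul_emission_e // eq_sym.
case: (boolP (f \in F)) => [fF|_]; first by rewrite (eqP (sF _ fF)) eqxx subrr.
by case: eqP; rewrite subr0.
Qed.
Lemma gap_nil u : gap u [::] = v u.
Proof. by rewrite /gap /emission big_nil subr0. Qed.

(** The ideal generated by the gaps lying in I. Since gaps are idempotent, the products a g b
    already include the gaps themselves, even if L has no unit. *)
Definition gap_ideal (I : nsort L -> Prop) : nsort L -> Prop :=
  lin_span (fun y => exists a b u F,
    [/\ emitted u F, I (gap u F) & y = a ** gap u F ** b]).

Section GapIdeal.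
Variable I : nsort L -> Prop.
Hypothesis idI : LPideal I.
Let J := gap_ideal I.
Let clI := ideal_linclosed idI.

Lemma gap_ideal_linclosed : linclosed J.
Proof. exact: lin_span_linclosed. Qed.
Let clJ := gap_ideal_linclosed.

Lemma gap_ideal_sub x : J x -> I x.
Proof.
apply: lin_span_sub => // _ [a [b [u [F [_ IF ->]]]]].
exact/(ideal_mulr idI)/(ideal_mull idI).
Qed.
Lemma gap_ideal_mull a x : J x -> J (a ** x).
Proof.
apply: (@lin_span_sub _ _ _ (fun x => J (a ** x))); first exact: nmul_subr_linclosed.
move=> _ [c [b [u [F [sF IF ->]]]]]; apply: lin_span_gen.
by exists (a ** c), b, u, F; rewrite !nmulA.
Qed.
Lemma gap_ideal_mulr a x : J x -> J (x ** a).
Proof.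
apply: (@lin_span_sub _ _ _ (fun x => J (x ** a))); first exact: nmul_subl_linclosed.
move=> _ [c [b [u [F [sF IF ->]]]]]; apply: lin_span_gen.
by exists c, (b ** a), u, F; rewrite !nmulA.
Qed.
Lemma gap_ideal_gap u F : emitted u F -> I (gap u F) -> J (gap u F).
Proof.
move=> sF IF; apply: lin_span_gen; exists (gap u F), (gap u F), u, F.
by rewrite !gap_idem.
Qed.

(** * Combinations of real paths ending at one vertex *)

Definition real_sum u (l : seq (K * seq E1)) := \sum_(p <- l) p.1 *: pe p.2 u.
Definition proper_terms (l : seq (K * seq E1)) := all (fun p => p.2 != [::]) l.

Lemma real_sum_v u l : real_sum u l ** v u = real_sum u l.
Proof.
rewrite /real_sum nmul_suml; apply: eq_bigr => p _.
by rewrite nmulZl pe_v.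
Qed.

Lemma real_sum_e u l f : s f = u -> exists l', real_sum u l ** e f = real_sum (r f) l'.
Proof.
move=> <-; exists [seq (p.1, rcons p.2 f) | p <- l].
rewrite /real_sum nmul_suml big_map; apply: eq_bigr => p _.
by rewrite nmulZl pe_rcons.
Qed.

(** No term is shorter than a, so a^* sends each one to 0, to u or to a nontrivial path; k collects
    the coefficients of the terms equal to a. *)
Lemma strip_sum a u l : pchain a u -> all (fun p => size a <= size p.2)%N l ->
  exists k l', [/\ (size l' <= size l)%N, proper_terms l' &
    ps a u ** real_sum u l = k *: v u + real_sum u l'].
Proof.
move=> ca; elim: l => [|p l IH] /=.
  by exists 0, [::]; rewrite /real_sum !big_nil nmul0r scale0r addr0.
move=> /andP[ap /IH [k [l' [sl pl el]]]].
rewrite /real_sum big_cons nmulDr -/(real_sum u l) el nmulZr mul_ps_pe //.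
case: ifP => _; last by exists k, l'; rewrite scaler0 add0r (leq_trans sl).
have [->|d0] := eqVneq (drop (size a) p.2) [::].
  by exists (p.1 + k), l'; rewrite scalerDl addrA (leq_trans sl).
exists k, ((p.1, drop (size a) p.2) :: l'); split=> //=; first by rewrite d0.
by rewrite /real_sum big_cons /= addrCA.
Qed.

(** Left multiplication by a a^* fixes the terms that factor through a and kills the others, so the
    difference merely deletes the former. *)
Lemma unstripped_sum a u l : pchain a u -> all (fun p => size a <= size p.2)%N l ->
  exists l', (size l' <= size l)%N /\
    real_sum u l - pe a u ** (ps a u ** real_sum u l) = real_sum u l'.
Proof.
move=> ca; elim: l => [|p l IH] /=.
  by exists [::]; rewrite /real_sum !big_nil !nmul0r subr0.
move=> /andP[ap /IH [l' [sl el]]].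
rewrite /real_sum big_cons !nmulDr -/(real_sum u l) opprD addrACA el !nmulZr.
rewrite mul_ps_pe //; case: ifP => [/andP[/prefixP[b eb]]|_]; last first.
  exists (p :: l'); split; first exact: sl.
  by rewrite nmul0r scaler0 subr0 /real_sum big_cons.
rewrite eb drop_size_cat // => /eqP sb; exists l'; split; first exact: leqW.
by rewrite pe_cat sb subrr add0r.
Qed.

Lemma shortest_term (l : seq (K * seq E1)) : l != [::] ->
  exists2 p, p \in l & all (fun q => size p.2 <= size q.2)%N l.
Proof.
elim: l => // p l IH _; have [->|/IH [q ql qmin]] := eqVneq l [::].
  by exists p; rewrite ?mem_head //= leqnn.
have [pq|/ltnW qp] := leqP (size p.2) (size q.2); last first.
  by exists q; rewrite ?inE ?ql ?orbT //= qp.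
exists p; rewrite ?mem_head //= leqnn /=.
by apply: sub_all qmin => t; apply: leq_trans.
Qed.

Lemma real_sum_rem u l p : p \in l -> real_sum u l = p.1 *: pe p.2 u + real_sum u (rem p l).
Proof. by move=> pl; rewrite /real_sum (perm_big _ (perm_to_rem pl)) big_cons. Qed.

(* Stripping a shortest path a off y: both (1 - a a^* ) y and a^* y are sums of
   fewer paths, up to a scalar multiple of u in the latter. *)
Lemma strip_reduction u Q :
  (forall k l, k != 0 -> proper_terms l ->
     I ((k *: v u + real_sum u l) ** Q) -> J ((k *: v u + real_sum u l) ** Q)) ->
  forall l, I (real_sum u l ** Q) -> J (real_sum u l ** Q).
Proof.
move=> base l; have [n] := ubnP (size l); elim: n l => // n IH l lt_n.
have [->|l0] := eqVneq l [::].
  by move=> _; rewrite /real_sum big_nil nmul0l; case: clJ.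
have [p pl pmin] := shortest_term l0; rewrite (real_sum_rem u pl).
set l1 := rem p l.
have s1 : (size l1 < n)%N.
  by rewrite size_rem // -ltnS prednK // lt0n size_eq0.
have min1 : all (fun q => size p.2 <= size q.2)%N l1.
  by apply/allP => q /mem_rem /(allP pmin).
(* A list that does not compose is 0 in L; dropping it shortens the sum. *)
have [cp|ncp] := boolP (pchain p.2 u); last first.
  by rewrite pe_nchain // scaler0 add0r; apply: IH.
set a := p.2 in min1 cp *; set y1 := real_sum u l1.
have [k [l2 [s2 pr2 e2]]] := strip_sum cp min1.
have [l3 [s3 e3]] := unstripped_sum cp min1.
rewrite -/y1 in e2 e3; set y := _ + y1 => Iy.
have ey : ps a u ** y = (p.1 + k) *: v u + real_sum u l2.
  by rewrite nmulDr nmulZr ps_pe // e2 addrA scalerDl.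
have e4 : y - pe a u ** (ps a u ** y) = real_sum u l3.
  rewrite -e3 /y nmulDr nmulZr ps_pe // nmulDr nmulZr pe_v opprD addrACA.
  by rewrite subrr add0r.
have IPQ : I (pe a u ** (ps a u ** y) ** Q).
  by rewrite -!nmulA; apply/(ideal_mull idI)/(ideal_mull idI).
rewrite -(subrK (pe a u ** (ps a u ** y)) y) nmulDl e4.
apply: linclosedD => //.
  apply: IH; first exact: leq_ltn_trans s1.
  rewrite -e4 nmulBl; apply: linclosedD => //; exact: linclosedN.
rewrite -nmulA; apply: gap_ideal_mull.
have : I (ps a u ** y ** Q) by rewrite -nmulA; apply: (ideal_mull idI).
(* If the coefficient of u cancels, a^* y is a sum with fewer terms and induction applies; otherwise
   [base] does. *)
rewrite ey; have [->|k0] := eqVneq (p.1 + k) 0; last exact: base.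
by rewrite scale0r add0r; apply: IH; apply: leq_ltn_trans s1.
Qed.

Hypothesis HK : LPcondition_K r s.

Lemma LPpath_pchain f l u : (LPpath r s f l /\ r (last f l) = u) <-> pchain (f :: l) u.
Proof.
elim: l f => [|g l IH] f /=; first by rewrite andbT; split=> [[_ ->]|/eqP].
split=> [[[-> pg] lg]|/andP[/eqP -> /IH [pg ->]]] //; rewrite eqxx.
exact/IH.
Qed.

(** Condition (K) gives a closed path at u whose edge set differs from that of g. The two cannot
    commute, since commuting words use the same letters. *)
Lemma noncommuting_cycles g u : g != [::] -> pchain g u -> psrc g u = u ->
  exists a b, [/\ pchain a u, psrc a u = u, pchain b u, psrc b u = u & a ++ b != b ++ a].
Proof.
case: g => // f l _ cl /= sf; have /LPpath_pchain [pl rl] := cl.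
have cfl : LPclosed_path r s f l by rewrite /LPclosed_path rl sf.
have [|f' [l' [[p' r'] sf' ne]]] := HK cfl (w := u); first by exists f; split=> //; left.
exists (f :: l), (f' :: l'); split=> //=.
  by apply/LPpath_pchain; rewrite r'.
apply/negP => /eqP eqab; apply: ne => g.
by rewrite (InE g (f :: l)) (InE g (f' :: l')) (@commuting_words_mem _ (f :: l) (f' :: l')).
Qed.

Lemma pchain_cat a b u : pchain (a ++ b) u = pchain a (psrc b u) && pchain b u.
Proof. by elim: a => //= f a ->; rewrite andbA; case: a. Qed.
Lemma psrc_cat a b u : psrc (a ++ b) u = psrc a (psrc b u).
Proof. by case: a. Qed.

(** Each rho^* g rho is 0 or a path of the same length as g, so nontrivial terms stay nontrivial;
    the count bounds the number of survivors. *)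
Lemma conj_sum rho u l : pchain rho u -> psrc rho u = u -> proper_terms l ->
  exists2 l', proper_terms l' & (size l' <= count (fun p => prefix rho (p.2 ++ rho) &&
      (psrc (drop (size rho) (p.2 ++ rho)) u == u)) l)%N /\
  ps rho u ** real_sum u l ** pe rho u = real_sum u l'.
Proof.
move=> cr sr; elim: l => [|p l IH] /=.
  by exists [::]; rewrite // /real_sum !big_nil nmul0r nmul0l.
move=> /andP[p0 /IH [l' pr [sl el]]].
have epe : pe p.2 u ** pe rho u = pe (p.2 ++ rho) u by rewrite pe_cat sr.
rewrite /real_sum big_cons nmulDr nmulDl -/(real_sum u l) el nmulZr nmulZl -nmulA epe.
rewrite mul_ps_pe ?size_cat ?leq_addl //; case: ifP => _.
  exists ((p.1, drop (size rho) (p.2 ++ rho)) :: l'); last first.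
    by rewrite /real_sum big_cons /= add1n ltnS.
  by rewrite /= pr -size_eq0 size_drop size_cat addnK size_eq0 p0.
by exists l' => //; rewrite scaler0 !add0r.
Qed.

Lemma base_vertex_in u k l : k != 0 -> proper_terms l ->
  I (k *: v u + real_sum u l) -> I (v u).
Proof.
move=> k0; have [n] := ubnP (size l); elim: n l => // n IH [|p l] lt_n.
  rewrite /real_sum big_nil addr0 => _ Iv.
  by rewrite -[v u](scalerK k0); apply: linclosedZ.
move=> /[dup] pr /= /andP[p0 prl] Iz.
(* conjugation by a closed path rho preserves the shape of the sum; it suffices
   that it kills the first term *)
have kill rho : pchain rho u -> psrc rho u = u ->
    ~~ (prefix rho (p.2 ++ rho) && (psrc (drop (size rho) (p.2 ++ rho)) u == u)) -> I (v u).
  move=> cr sr nr; have [l' prl' [sl' el']] := conj_sum cr sr pr.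
  apply: (IH l') => //.
    move: sl'; rewrite /= (negPf nr) add0n => sl'.
    exact: leq_ltn_trans (leq_trans sl' (count_size _ _)) lt_n.
  have := ideal_mulr idI (pe rho u) (ideal_mull idI (ps rho u) Iz).
  rewrite nmulDr nmulDl el' nmulZr nmulZl mul_psv sr eqxx ps_pe //.
(* A term that does not start at u dies under conjugation by the trivial path u. *)
have [sp|nsp] := eqVneq (psrc p.2 u) u; last first.
  by apply: (kill [::]) => //; rewrite cats0 drop0 prefix0s.
have [cp|ncp] := boolP (pchain p.2 u); last first.
  apply: (IH l) => //; move: Iz.
  by rewrite /real_sum big_cons pe_nchain // scaler0 add0r.
have [a [b [ca sa cb sb nab]]] := noncommuting_cycles p0 cp sp.
have [pab|nab'] := boolP (prefix (a ++ b) (p.2 ++ (a ++ b))); last first.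
  apply: (kill (a ++ b)); rewrite ?(negPf nab') //.
    by rewrite pchain_cat sb ca.
  by rewrite psrc_cat sb.
apply: (kill (b ++ a)); first by rewrite pchain_cat sa cb.
  by rewrite psrc_cat sa.
(* The words a b and b a have the same length; if both were initial segments of g g g ... they would
   coincide. *)
rewrite negb_and; apply/orP; left; apply/negP => pba.
move/eqP: nab; apply; apply: prefix_shift_inj pab pba => //.
by rewrite !size_cat addnC.
Qed.

(** Take Q = u in [strip_reduction]: once u occurs with a nonzero coefficient, u is in I, and u is
    the gap of the empty set of edges. *)
Lemma real_sum_reduction u l : I (real_sum u l) -> J (real_sum u l).
Proof.
rewrite -[real_sum u l]real_sum_v; apply: strip_reduction => k l' k0 pr Iz.
have Iz' : I (k *: v u + real_sum u l').
  by move: Iz; rewrite nmulDl nmulZl real_sum_v mul_vv eqxx.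
apply: gap_ideal_mull; rewrite -gap_nil; apply: gap_ideal_gap => //.
by rewrite gap_nil; apply: base_vertex_in Iz'.
Qed.

(** Take Q = [gap u F] in [strip_reduction]. Enlarging F by the first edges of the nontrivial terms
    gives a gap that kills them, so k times the enlarged gap lies in I. What remains of Q passes
    through finitely many edges, and multiplying by one of them gives a real sum again. *)
Lemma real_gap_reduction u F l : emitted u F ->
  I (real_sum u l ** gap u F) -> J (real_sum u l ** gap u F).
Proof.
move=> sF; apply: strip_reduction => k {}l k0 pr; set z := _ + _ => Iz.
have [l1 ez] : exists l1, z = real_sum u l1.
  by exists ((k, [::]) :: l); rewrite /real_sum big_cons.
pose heads := [seq f <- flatten [seq take 1 p.2 | p <- l] | s f == u].
pose F' := undup (F ++ heads).
have FF' : {subset F <= F'} by move=> f fF; rewrite mem_undup mem_cat fF.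
have sF' : emitted u F'.
  rewrite /emitted undup_uniq; apply/allP => f; rewrite mem_undup mem_cat.
  case/orP => [fF|]; last by rewrite mem_filter => /andP[].
  by case/andP: sF => _ /allP; apply.
have kill : gap u F' ** real_sum u l = 0.
  rewrite /real_sum nmul_sumr big_seq big1 // => -[c [|f g]] pl.
    by have := allP pr _ pl.
  rewrite nmulZr /= nmulA mul_gap_e //; case: eqP => sf /=; last first.
    by rewrite nmul0l scaler0.
  rewrite mem_undup mem_cat mem_filter sf eqxx /=.
  suff -> : f \in flatten [seq take 1 p.2 | p <- l] by rewrite orbT nmul0l scaler0.
  apply/flattenP; exists [:: f]; last exact: mem_head.
  by apply/mapP; exists (c, f :: g); rewrite //= take0.
have Ig : I (gap u F').
  have g'v : gap u F' ** v u = gap u F'.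
    by rewrite nmulBl mul_vv eqxx (proj2 (emission_v sF')).
  have g'z : gap u F' ** z = k *: gap u F' by rewrite nmulDr kill addr0 nmulZr g'v.
  have := ideal_mull idI (gap u F') Iz.
  rewrite nmulA g'z nmulZl gap_mul // => Ikg.
  by rewrite -[gap u F'](scalerK k0); apply: linclosedZ.
(* The first summand is the gap just shown to be in I; the second is a sum over the edges of F'. *)
have eg : gap u F = gap u F' + gap u F ** emission F'.
  rewrite [in X in _ = _ + X]/gap nmulBl (proj1 (emission_v sF')).
  rewrite (proj1 (emission_mul _ FF')) ?undup_uniq // /gap.
  by rewrite addrA subrK.
rewrite eg nmulDr; apply: linclosedD => //.
  exact/gap_ideal_mull/gap_ideal_gap.
rewrite nmulA /emission nmul_sumr big_seq.
apply: (big_ind J) => [|x y|f fF']; [by case: clJ | exact: linclosedD |].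
rewrite nmulA; apply: gap_ideal_mulr.
have sf : s f = u by case/andP: sF' => _ /allP /(_ f fF') /eqP.
have := ideal_mulr idI (e f) Iz; rewrite -nmulA mul_gap_e // sf eqxx /=.
case: ifP => _; last by rewrite nmul0r; case: clJ.
have [l2 e2] := real_sum_e l1 sf.
by rewrite ez e2; apply: real_sum_reduction.
Qed.

(** Filtration of L u by the length of the ghost factor, the induction parameter of
    [ghost_bounded_reduction]. *)
Definition ghost_bounded m u : nsort L -> Prop :=
  lin_span (fun y => exists a b z,
    [/\ (size b <= m)%N, psrc b z = u & y = pe a z ** ps b z]).

Lemma ghost_bounded_e m f x :
  ghost_bounded m.+1 (s f) x -> ghost_bounded m (r f) (x ** e f).
Proof.
have clG : linclosed (ghost_bounded m (r f)) by apply: lin_span_linclosed.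
have G0 := proj1 clG.
apply: (@lin_span_sub _ _ _ (fun x => ghost_bounded m (r f) (x ** e f))).
  exact: nmul_subl_linclosed.
move=> _ [a [[|g b] [z [sb sz ->]]]] /=.
  rewrite pe_v /= in sz *; rewrite sz -pe_rcons.
  by apply: lin_span_gen; exists (rcons a f), [::], (r f); rewrite pe_v.
rewrite -!nmulA mul_ese; case: eqP => [->|_]; last by rewrite !nmul0r.
rewrite mul_psv; case: eqP => [rf|_]; last by rewrite nmul0r.
by apply: lin_span_gen; exists a, b, z.
Qed.

(** Terms without ghost edges form the real sum. F collects the edges f for which f^* is the
    rightmost factor of another term, so [emission F] fixes those terms. *)
Lemma ghost_bounded_split m u x : ghost_bounded m u x ->
  exists F l x1, [/\ emitted u F, x = real_sum u l + x1 & x1 ** emission F = x1].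
Proof.
elim=> [|k _ y [a [b [z [_ sb ->]]]] _ [F [l [x1 [sF -> e1]]]]].
  by exists [::], [::], 0; rewrite /real_sum big_nil addr0 nmul0l.
case: b sb => [|f b] /= sb.
  exists F, ((k, a) :: l), x1; split=> //.
  by rewrite -sb pe_v /real_sum big_cons /= sb addrA.
have sF' : emitted u (undup (f :: F)).
  case/andP: sF => _ aF; rewrite /emitted undup_uniq; apply/allP => g.
  by rewrite mem_undup inE => /orP[/eqP ->|/(allP aF)//]; apply/eqP.
exists (undup (f :: F)), l, (k *: (pe a z ** (ps b z ** es f)) + x1).
split=> //; first by rewrite addrCA.
rewrite nmulDl nmulZl -!nmulA mul_es_emission ?undup_uniq //.
rewrite mem_undup mem_head; congr (_ + _).
rewrite -{1}e1 -nmulA (proj1 (emission_mul _ _)) ?undup_uniq //.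
by move=> g gF; rewrite mem_undup inE gF orbT.
Qed.

Lemma ghost_bounded0 u x : ghost_bounded 0 u x -> exists l, x = real_sum u l.
Proof.
elim=> [|k _ y [a [b [z [sb zb ->]]]] _ [l ->]].
  by exists [::]; rewrite /real_sum big_nil.
case: b sb zb => // _ /= ->.
by exists ((k, a) :: l); rewrite pe_v /real_sum big_cons.
Qed.

(** Split x into x [gap u F] and x [emission F]. The latter is a sum of (x f) f^* with shorter ghost
    factors in x f; in the former the ghost terms vanish, leaving a real sum times a gap. *)
Lemma ghost_bounded_reduction m u x : ghost_bounded m u x -> I x -> J x.
Proof.
elim: m u x => [|m IH] u x Gx Ix.
  by have [l ex] := ghost_bounded0 Gx; rewrite ex in Ix *; apply: real_sum_reduction.
have [F [l [x1 [sF ex e1]]]] := ghost_bounded_split Gx.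
have Jx : J (x ** emission F).
  rewrite /emission nmul_sumr big_seq.
  apply: (big_ind J) => [|y z|f fF]; [by case: clJ | exact: linclosedD |].
  rewrite nmulA; apply: gap_ideal_mulr; apply: (IH (r f)); last exact: ideal_mulr.
  by apply: ghost_bounded_e; case/andP: sF => _ /allP /(_ f fF) /eqP ->.
have ey : x = real_sum u l ** gap u F + x ** emission F.
  by rewrite ex nmulBr nmulDl e1 real_sum_v addrA subrK.
rewrite ey; apply: linclosedD => //; apply: real_gap_reduction => //.
have -> : real_sum u l ** gap u F = x - x ** emission F by rewrite {1}ey addrK.
by apply: linclosedD => //; apply: linclosedN => //; apply: ideal_mulr.
Qed.

Lemma ghost_bounded_ex x : exists m, forall u, ghost_bounded m u (x ** v u).
Proof.
have mono m m' u y : (m <= m')%N -> ghost_bounded m u y -> ghost_bounded m' u y.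
  move=> mm; apply: lin_span_sub; first exact: lin_span_linclosed.
  move=> _ [a [b [z [sb sz ->]]]]; apply: lin_span_gen; exists a, b, z.
  by rewrite (leq_trans sb).
have := normal_span x; elim=> [|k _ y [a [b [z ->]]] _ [m IH]].
  by exists 0%N => u; rewrite nmul0l; apply: lin_span0.
exists (maxn m (size b)) => u; rewrite nmulDl nmulZl.
apply: linclosedD; [exact: lin_span_linclosed| |exact: mono (leq_maxl _ _) (IH u)].
apply: linclosedZ; first exact: lin_span_linclosed.
rewrite -nmulA mul_psv; case: eqP => [->|_].
  by apply: lin_span_gen; exists a, b, z; rewrite leq_maxr.
by rewrite nmul0r; apply: lin_span0.
Qed.

(** A local unit splits x into finitely many components x u, each with ghost factors of bounded
    length. *)
Theorem ideal_eq_gap_ideal x : I x <-> J x.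
Proof.
split; last exact: gap_ideal_sub.
move=> Ix; have [U [_ <-]] := right_unit x; rewrite nmul_sumr.
have [m Gx] := ghost_bounded_ex x.
apply: (big_ind J) => [|y z|u _]; [by case: clJ | exact: linclosedD |].
by apply: ghost_bounded_reduction (Gx u) _; apply: ideal_mulr.
Qed.
End GapIdeal.
End Reduction.

(** * Graded and idempotent ideals *)

Lemma In_cat (T : Type) (a b : seq T) p :
  List.In p (a ++ b) -> List.In p a \/ List.In p b.
Proof. by elim: a => [|q a IH] /=; [right | case=> [->|/IH []]; auto]. Qed.

Lemma In_map (T U : Type) (f : T -> U) (l : seq T) p :
  List.In p (map f l) -> exists2 q, List.In q l & p = f q.
Proof.
elim: l => //= q l IH [<-|/IH [q' ? ->]]; first by exists q; auto.
by exists q'; auto.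
Qed.

Section Grading.
Variables (K : fieldType) (E0 E1 : Type) (L : nalgType K).
Variables (v : E0 -> nsort L) (e es : E1 -> nsort L).
Local Notation "x ** y" := (@nmul K L x y) (at level 40, left associativity).
Local Notation homog := (LPhomog v e es).

Lemma homog_linclosed n : linclosed (homog n).
Proof.
split=> [|k x y [l [dl ->]] [l' [dl' ->]]]; first by exists [::]; rewrite big_nil.
exists ([seq (k * p.1, p.2) | p <- l] ++ l'); split.
  move=> p pl; case: (In_cat pl) => {}pl; last exact: dl'.
  by have [q /dl ? ->] := In_map pl.
rewrite big_cat big_map scaler_sumr /=; congr (_ + _).
by apply: eq_bigr => p _; rewrite scalerA.
Qed.

Lemma homog_weval gw : homog (wdeg gw) (weval v e es gw).
Proof.
by exists [:: (1, gw)]; split=> [p [<-|[]]|] //; rewrite big_seq1 scale1r.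
Qed.

Lemma weval_cat gw gw' :
  weval v e es gw ** weval v e es gw' = weval v e es (gw.1, gw.2 ++ gw'.1 :: gw'.2).
Proof.
case: gw => g w; case: gw' => g' w' /=; rewrite /weval /= foldl_cat /=.
elim/last_ind: w' => [//|w' h IH].
by rewrite !foldl_rcons nmulA IH.
Qed.

Lemma homogM n n' x y : homog n x -> homog n' y -> homog (n + n') (x ** y).
Proof.
move=> [l [dl ->]] [l' [dl' ->]].
have [H0 HD] := homog_linclosed (n + n'); rewrite nmul_suml.
elim: l dl => [|p l IH] dl; first by rewrite big_nil.
have Hp := dl p (or_introl erefl).
rewrite big_cons nmulZl; apply: (HD); last by apply: IH => q ?; apply: dl; right.
rewrite nmul_sumr; elim: l' dl' {IH} => [|p' l' IH'] dl'; first by rewrite big_nil.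
rewrite big_cons nmulZr; apply: (HD); last by apply: IH' => q ?; apply: dl'; right.
have <- := dl' p' (or_introl erefl); rewrite -Hp weval_cat.
have -> : wdeg p.2 + wdeg p'.2 = wdeg (p.2.1, p.2.2 ++ p'.2.1 :: p'.2.2).
  by rewrite /wdeg /= big_cat big_cons /= !addrA.
exact: homog_weval.
Qed.

(** The conclusion of [LPgraded] as a predicate on x, so that its closure under linear combinations
    can be used. *)
Definition homog_sum (I : nsort L -> Prop) x := exists l : seq (int * nsort L),
  (forall p, List.In p l -> I p.2 /\ homog p.1 p.2) /\ x = \sum_(p <- l) p.2.

Lemma homog_sum_linclosed I : linclosed I -> linclosed (homog_sum I).
Proof.
move=> clI; split=> [|k x y [l [dl ->]] [l' [dl' ->]]].
  by exists [::]; rewrite big_nil.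
exists ([seq (p.1, k *: p.2) | p <- l] ++ l'); split; last first.
  by rewrite big_cat big_map scaler_sumr.
move=> p pl; case: (In_cat pl) => {}pl; last exact: dl'.
have [q /dl [Iq hq] ->] := In_map pl; split; apply: linclosedZ => //.
exact: homog_linclosed.
Qed.

Lemma homog_sum1 (I : nsort L -> Prop) n x : I x -> homog n x -> homog_sum I x.
Proof.
by move=> Ix hx; exists [:: (n, x)]; split=> [p [<-|[]]|] //; rewrite big_seq1.
Qed.

End Grading.

(** * Products and intersections of idempotent ideals *)

Section ProductIdeals.
Variables (K : fieldType) (L : nalgType K).
Implicit Types I J : nsort L -> Prop.

Lemma LPprod_sub I J x : LPideal I -> LPideal J -> LPprod I J x -> I x /\ J x.
Proof.
move=> [I0 ID _ _ Ir] [J0 JD _ Jl _] [l [dl ->]].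
elim: l dl => [|p l IH] dl; first by rewrite big_nil.
have [Ip Jp] := dl p (or_introl erefl).
have [|Il Jl'] := IH; first by move=> q ql; apply: dl; right.
by rewrite big_cons; split; [apply/ID/Il/Ir | apply/JD/Jl'/Jl].
Qed.

Lemma LPprod_mono I I' J J' x :
  LPsub I I' -> LPsub J J' -> LPprod I J x -> LPprod I' J' x.
Proof.
by move=> II JJ [l [dl ->]]; exists l; split=> // p /dl [Ip Jp]; split; auto.
Qed.

Lemma LPideal_cap I J : LPideal I -> LPideal J -> LPideal (fun x => I x /\ J x).
Proof.
move=> [I0 ID IN Il Ir] [J0 JD JN Jl Jr]; split=> //.
- by move=> x y [Ix Jx] [Iy Jy]; auto.
- by move=> x [Ix Jx]; auto.
- by move=> a x [Ix Jx]; auto.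
- by move=> a x [Ix Jx]; auto.
Qed.

Hypothesis idem : forall I, LPideal I -> LPsub I (LPprod I I).

(** The intersection is an idempotent ideal, and its square lies in I J. *)
Lemma LPprod_idem_cap I J : LPideal I -> LPideal J ->
  LPprod I J = (fun x => I x /\ J x).
Proof.
move=> idI idJ; apply/funext => x; apply/propext; split; first exact: LPprod_sub.
move/(idem (LPideal_cap idI idJ)).
by apply: LPprod_mono => y [].
Qed.

Lemma LPprod_list_idem I ps x : LPideal I -> (forall P, List.In P ps -> LPideal P) ->
  LPprod_list I ps x <-> LPcap_list I ps x.
Proof.
rewrite /LPprod_list /LPcap_list.
elim: ps I => [|P ps IH] I idI idps /=.
  by split=> [Ix P [<-|[]]//|]; apply; left.
have idP := idps P (or_introl erefl).
rewrite LPprod_idem_cap // IH; first 1 last.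
- exact: LPideal_cap.
- by move=> Q Qps; apply: idps; right.
split=> h Q.
  have [Ix Px] := h _ (or_introl erefl).
  by case=> [<-|[<-|Qps]] //; apply: h; right.
by case=> [<-|Qps]; [split; apply: h; auto | apply: h; auto].
Qed.

End ProductIdeals.

Section ConditionK.
Variables (K : fieldType) (E0 E1 : eqType) (r s : E1 -> E0) (L : nalgType K).
Variables (v : E0 -> nsort L) (e es : E1 -> nsort L).
Hypotheses (HL : is_leavitt_path_algebra r s v e es) (HK : LPcondition_K r s).
Implicit Types I : nsort L -> Prop.

(** For an idempotent gap g in I, the generator a g b factors as (a g)(g b) with both factors in
    I. *)
Lemma condition_K_idem I : LPideal I -> LPsub I (LPprod I I).
Proof.
move=> idI x /(ideal_eq_gap_ideal HL idI HK).
elim=> [|k _ y [a [b [u [F [sF IF ->]]]]] _ [l [dl ->]]].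
  by exists [::]; rewrite big_nil.
exists ((k *: nmul a (gap v e es u F), nmul (gap v e es u F) b) :: l); split.
  move=> p [<-|/dl //] /=; split; last exact: (ideal_mulr idI).
  apply: linclosedZ; first exact: ideal_linclosed HL _ idI.
  exact: (ideal_mull idI).
by rewrite big_cons nmulZl -!nmulA [nmul (gap _ _ _ _ _) (nmul _ b)]nmulA (gap_idem HL).
Qed.

Lemma homog_gap u F : LPhomog v e es 0 (gap v e es u F).
Proof.
have clH := homog_linclosed v e es 0; have hg g := homog_weval v e es (g, [::]).
apply: linclosedD => //.
  by have := hg (GV _ u); rewrite /wdeg big_nil addr0.
apply: linclosedN => //; rewrite /emission.
apply: (big_ind (LPhomog v e es 0)) => [|x y|f _]; [by case: clH | exact: linclosedD |].
have := homogM (hg (GE _ f)) (hg (GS _ f)).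
by rewrite /wdeg !big_nil.
Qed.

(** In a generator a g b both a and b may be taken to be words; g has degree 0, so the product is
    homogeneous. *)
Lemma condition_K_graded I : LPideal I -> LPgraded v e es I.
Proof.
move=> idI x /(ideal_eq_gap_ideal HL idI HK).
have clI := ideal_linclosed HL idI.
have clS := homog_sum_linclosed v e es clI; apply: (lin_span_sub clS).
move=> _ [a [b [u [F [sF IF ->]]]]]; rewrite -nmulA; set g := gap _ _ _ _ _ in IF *.
have clSa y := nmul_subl_linclosed y clS.
apply: (lin_span_sub (clSa (nmul g b))) (words_span HL a) => _ [gw ->].
rewrite nmulA; have clSb y := nmul_subr_linclosed y clS.
apply: (lin_span_sub (clSb (nmul (weval v e es gw) g))) (words_span HL b) => _ [gw' ->].
apply: (@homog_sum1 _ _ _ _ _ _ _ _ (wdeg gw + 0 + wdeg gw')).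
  exact/(ideal_mulr idI)/(ideal_mull idI).
by apply: homogM (homog_weval _ _ _ _); apply: homogM (homog_gap _ _); apply: homog_weval.
Qed.

End ConditionK.

(** * Representations on infinite paths *)

Definition stail (T : Type) (x : nat -> T) : nat -> T := fun i => x i.+1.
Definition scons (T : Type) (a : T) (x : nat -> T) : nat -> T :=
  fun i => if i is j.+1 then x j else a.

Lemma scons_stail (T : Type) (x : nat -> T) : scons (x 0%N) (stail x) = x.
Proof. by apply/funext; case. Qed.

Section PathRepresentation.
Variables (K : fieldType) (E0 E1 : eqType) (r s : E1 -> E0) (L : nalgType K).
Variables (v : E0 -> nsort L) (e es : E1 -> nsort L).
Hypothesis HL : is_leavitt_path_algebra r s v e es.

(* A set of infinite paths closed under shifts in both directions. *)
Variable X : pred (nat -> E1).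
Hypothesis Xpath : forall x, X x -> r (x 0%N) = s (x 1%N).
Hypothesis Xtail : forall x, X x -> X (stail x).
Hypothesis Xcons : forall g x, X x -> r g = s (x 0%N) -> X (scons g x).

Section Twisted.
Variables (W : lmodType K) (t ti : E1 -> W -> W).
Hypotheses (tlin : forall g, linear (t g)) (tilin : forall g, linear (ti g)).
Hypotheses (tK : forall g, cancel (t g) (ti g)) (tiK : forall g, cancel (ti g) (t g)).
Let V : lmodType K := (nat -> E1) -> W.

(** A twisted form of Chen's module of infinite paths, on all functions instead of finitely
    supported ones. On delta functions [act_e g] prefixes g and applies [t g], while [act_es g]
    removes g and applies [ti g]. *)
Definition act_v w (f : V) : V := fun x => if X x && (s (x 0%N) == w) then f x else 0.
Definition act_e g (f : V) : V :=
  fun x => if X x && (x 0%N == g) then t g (f (stail x)) else 0.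
Definition act_es g (f : V) : V :=
  fun x => if X x && (s (x 0%N) == r g) then ti g (f (scons g x)) else 0.

Fact act_v_linear w : linear (act_v w).
Proof.
move=> a f g; apply/funext => x; rewrite /act_v /= !fctE.
by case: ifP => _; rewrite ?scaler0 ?addr0.
Qed.
Fact act_e_linear g : linear (act_e g).
Proof.
move=> a f f'; apply/funext => x; rewrite /act_e /= !fctE.
by case: ifP => _; rewrite ?tlin ?scaler0 ?addr0.
Qed.
Fact act_es_linear g : linear (act_es g).
Proof.
move=> a f f'; apply/funext => x; rewrite /act_es /= !fctE.
by case: ifP => _; rewrite ?tilin ?scaler0 ?addr0.
Qed.

Lemma act_family : leavitt_family r s
  (fun w => insubmod (linear_linclosed V) (act_v_linear w) : nsort (endalg V))
  (fun g => insubmod (linear_linclosed V) (act_e_linear g) : nsort (endalg V))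
  (fun g => insubmod (linear_linclosed V) (act_es_linear g) : nsort (endalg V)).
Proof.
split; first move=> w.
  apply: val_inj; apply/funext => f; apply/funext => x /=; rewrite /act_v.
  by case: ifP => // ->.
split; first move=> w w' ww'.
  apply: val_inj; apply/funext => f; apply/funext => x /=; rewrite /act_v.
  case: ifP => [/andP[-> /eqP ->]|//]; by case: eqP ww'.
split; first move=> g; first split.
- apply: val_inj; apply/funext => f; apply/funext => x /=; rewrite /act_v /act_e.
  case: ifP => [/andP[-> _]//|]; case: ifP => //.
  by case/andP => -> /eqP ->; rewrite eqxx.
- apply: val_inj; apply/funext => f; apply/funext => x /=; rewrite /act_v /act_e.
  case: ifP => // /andP[Xx /eqP <-].
  by rewrite Xtail // /stail -Xpath // eqxx.
split; first move=> g; first split.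
- apply: val_inj; apply/funext => f; apply/funext => x /=; rewrite /act_v /act_es.
  by case: ifP => [-> |//].
- apply: val_inj; apply/funext => f; apply/funext => x /=; rewrite /act_v /act_es.
  by case: ifP => // /andP[Xx /eqP xg]; rewrite Xcons //= eqxx.
split; first move=> g.
  apply: val_inj; apply/funext => f; apply/funext => x /=.
  rewrite /act_v /act_e /act_es /=; case: ifP => // /andP[Xx /eqP xg].
  by rewrite Xcons //= eqxx tK.
split; first move=> g h gh.
  apply: val_inj; apply/funext => f; apply/funext => x /=.
  rewrite /act_e /act_es /=; case: ifP => // _; case: eqP gh => // _ _.
  by rewrite andbF (linear_at0 (tilin g)).
move=> w l _ /NoDupE ul sl; apply: val_inj => /=; rewrite subval_sum.
apply/funext => f; apply/funext => x; rewrite !fct_sumE /= /act_v.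
(* Here g g^* is restriction to the paths in X that begin with g; summing over the edges out of w
   gives restriction to those that start at w. *)
have term g : act_e g (act_es g f) x = if X x && (x 0%N == g) then f x else 0.
  rewrite /act_e /act_es; case: ifP => // /andP[Xx /eqP <-].
  by rewrite Xtail // {1}/stail -Xpath // eqxx tiK scons_stail.
rewrite (eq_bigr _ (fun g _ => term g)); case Xx: (X x) => /=; last by rewrite big1.
case: (eqVneq (s (x 0%N)) w) => [/sl/InE xl|nw].
  rewrite (bigD1_seq (x 0%N)) //= eqxx big1 ?addr0 // => g.
  by rewrite eq_sym => /negPf ->.
rewrite big_seq big1 // => g /InE/sl sg; case: eqP => // xg.
by move: nw; rewrite xg sg eqxx.
Qed.

Definition is_path_rep (phi : nsort L -> V -> V) : Prop :=
  [/\ forall x, linear (phi x),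
      (forall a x y f, phi (a *: x + y) f = a *: phi x f + phi y f),
      (forall x y f, phi (nmul x y) f = phi x (phi y f)) &
      [/\ forall w, phi (v w) = act_v w, forall g, phi (e g) = act_e g
        & forall g, phi (es g) = act_es g]].

Lemma path_rep_ex : exists phi, is_path_rep phi.
Proof.
have [[phi [[phiD phiZ phiM] [pv [pe' ps']]]] _] := proj2 HL _ _ _ _ act_family.
exists (fun x => subval (phi x)); split.
- by move=> x; apply: (subvalP (phi x)).
- by move=> a x y f; rewrite phiD phiZ.
- by move=> x y f; rewrite phiM.
- by split=> g; rewrite ?pv ?pe' ?ps'.
Qed.

End Twisted.
End PathRepresentation.

(** * The infinite path obtained when Condition (K) fails *)

Section UniqueCycle.
Variables (E0 E1 : eqType) (r s : E1 -> E0).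

(* X is the shift-equivalence class of the periodic path z = c c c ...; z is its
   only member that starts at w. *)
Record path_class (X : pred (nat -> E1)) (z : nat -> E1) (w : E0) (c : seq E1) : Prop :=
  PathClass {
    class_path : forall x, X x -> r (x 0%N) = s (x 1%N);
    class_tail : forall x, X x -> X (stail x);
    class_cons : forall g x, X x -> r g = s (x 0%N) -> X (scons g x);
    class_ind : forall T : (nat -> E1) -> Prop, T z ->
      (forall x, X x -> T x -> T (stail x)) ->
      (forall x, X x -> T (stail x) -> T x) -> forall x, X x -> T x;
    class_base : X z;
    class_unique : forall x, X x -> s (x 0%N) = w -> x = z;
    class_source : s (z 0%N) = w;
    class_cycle : c != [::] /\ uniq c;
    class_chain : pchain r s c w;
    class_psrc : psrc s c w = w }.

Definition cycle_at w (l : seq E1) := [&& l != [::], pchain r s l w & psrc s l w == w].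

Lemma LPpath_cycle f l : LPclosed_path r s f l <-> cycle_at (s f) (f :: l).
Proof.
by rewrite /LPclosed_path LPpath_pchain /cycle_at /= eqxx andbT.
Qed.

Lemma not_uniq_split (l : seq E1) : ~~ uniq (map s l) ->
  exists a f b g d, l = a ++ f :: b ++ g :: d /\ s f = s g.
Proof.
elim: l => //= x l IH; rewrite negb_and negbK => /orP[/mapP[g]|/IH].
  by case/splitPr => b d sx; exists [::], x, b, g, d.
by move=> [a [f [b [g [d [-> sfg]]]]]]; exists (x :: a), f, b, g, d.
Qed.

Lemma uniq_map_inj (l : seq E1) : uniq (map s l) -> {in l &, injective s}.
Proof.
elim: l => //= x l IH /andP[xl /IH inj] f g; rewrite !inE.
case/orP => [/eqP ->|fl]; case/orP => [/eqP ->|gl] //; last exact: inj.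
  by move=> e; case/negP: xl; rewrite e map_f.
by move=> e; case/negP: xl; rewrite -e map_f.
Qed.

Lemma pchain_iota (x : nat -> E1) j m : (forall i, r (x i) = s (x i.+1)) ->
  pchain r s [seq x i | i <- iota j m] (s (x (j + m)%N)) /\
  psrc s [seq x i | i <- iota j m] (s (x (j + m)%N)) = s (x j).
Proof.
move=> px; elim: m j => [|m IH] j; first by rewrite addn0.
by have [cm sm] := IH j.+1; rewrite -addSnnS /= sm px eqxx.
Qed.

(** Failure of (K) yields a vertex w all of whose closed paths have the same edge set; c is a
    shortest one. *)
Lemma unique_cycle : ~ LPcondition_K r s ->
  exists w c, [/\ cycle_at w c, uniq (map s c) &
    forall l, cycle_at w l -> {subset l <= c}].
Proof.
move=> nK; have [w [S [l0 [cl0 Sw]]]] : exists w (S : seq E1) l0, cycle_at w l0 /\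
    forall l, cycle_at w l -> l =i S.
  apply: contrapT => nex; apply: nK => f l cl w [g [/InE gl sg]].
  apply: contrapT => nex'; apply: nex.
  move: nex'; case/LPpath_cycle/and3P: cl => _; case/splitPr: gl => a b.
  rewrite pchain_cat psrc_cat => /andP[ca cgb] /eqP sa nex.
  (* The given closed path is rotated to start at w. *)
  exists w, (a ++ g :: b), (g :: b ++ a); split.
    rewrite /cycle_at -cat_cons pchain_cat psrc_cat /= sg eqxx andbT.
    by move: ca cgb; rewrite -{2}sa /= sg => -> ->.
  case=> // f' l' cl' x; move: (cl') => /and3P[_ _ /eqP /= sf'].
  apply: contrapT => nx; apply: nex; exists f', l'; split=> //.
    by apply/LPpath_cycle; rewrite sf'.
  by move=> h; apply: nx; apply/idP/idP => /InE/h/InE.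
have [c cyc_c cmin] : exists2 c, cycle_at w c &
    forall l, cycle_at w l -> (size c <= size l)%N.
  have exP : exists n, `[< exists2 l, cycle_at w l & size l = n >].
    by exists (size l0); apply/asboolP; exists l0.
  case: (ex_minnP exP) => n /asboolP[c cc sc] nmin; exists c => // l cl.
  by rewrite sc; apply: nmin; apply/asboolP; exists l.
exists w, c; split=> //; last by move=> l /Sw Sl x; rewrite Sl -(Sw c).
(* Two edges of c with the same source would allow the segment between them to be cut out, against
   minimality. *)
apply: contraT => /not_uniq_split[a [f [b [g [d [ec sfg]]]]]].
have : cycle_at w (a ++ g :: d).
  move: cyc_c; rewrite ec /cycle_at !pchain_cat -cat_cons pchain_cat !psrc_cat /= sfg.
  case: (a) => [|a0 a'] /=; first by case/andP => /and3P[_ -> ->] ->.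
  by case/andP => /and4P[-> _ -> ->] ->.
by move/cmin; rewrite ec !size_cat /= size_cat /=; lia.
Qed.

(** X consists of the infinite paths sharing a tail with z = c c c .... The crucial field is
    [class_unique]: a member starting at w reaches z through a closed path at w, hence uses only
    edges of c. *)
Lemma not_K_path_class : ~ LPcondition_K r s ->
  exists X z w c, path_class X z w c.
Proof.
move=> /unique_cycle [w [c [cyc_c uc subc]]].
case: c cyc_c uc subc => // f0 c'; set c := f0 :: c' => cyc_c uc subc.
pose n := size c; pose z i := nth f0 c (i %% n).
have zc i : z i \in c by rewrite mem_nth // ltn_mod.
have z_per i k : z (i + k * n)%N = z i by rewrite /z addnC modnMDl.
have sz0 : s (z 0%N) = w by rewrite /z mod0n; have /and3P[_ _ /eqP] := cyc_c.
have z_path i : r (z i) = s (z i.+1).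
  have chain_nth l u j : pchain r s l u -> (j < size l)%N ->
      r (nth f0 l j) = if (j.+1 < size l)%N then s (nth f0 l j.+1) else u.
    elim: l j => // g l IH [|j] /= /andP[/eqP rg cl]; first by rewrite rg; case: (l).
    exact: IH.
  case/and3P: (cyc_c) => _ ch _; have in_n : (i %% n < n)%N by rewrite ltn_mod.
  rewrite /z (chain_nth _ _ _ ch in_n) -/n -[in RHS]addn1 -modnDml addn1.
  case: ltnP => [lt_i|ge_i]; first by rewrite (modn_small lt_i).
  have -> : (i %% n).+1 = n by apply/eqP; rewrite eqn_leq in_n ge_i.
  by rewrite modnn -sz0 /z mod0n.
pose X x := `[< (forall i, r (x i) = s (x i.+1)) /\
                exists m k, forall i, x (i + m)%N = z (i + k)%N >].
have inj := uniq_map_inj uc.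
have Xz : X z by apply/asboolP; split=> //; exists 0%N, 0%N.
have Xtl x : X x -> X (stail x).
  move=> /asboolP[px [m [k xz]]]; apply/asboolP; split; first by move=> i; apply: px.
  by exists m, k.+1 => i; rewrite /stail -addSn xz addSnnS.
pose shift (x : nat -> E1) j i := x (i + j)%N.
have shift0 x : shift x 0%N = x by apply/funext => i; rewrite /shift addn0.
have shiftS x j : shift x j.+1 = stail (shift x j).
  by apply/funext => i; rewrite /shift /stail addSnnS.
have Xshift x j : X x -> X (shift x j).
  by move=> Xx; elim: j => [|j IH]; rewrite ?shift0 ?shiftS //; apply: Xtl.
exists X, z, w, c; split=> //.
- by move=> x /asboolP[px _].
- move=> g x /asboolP[px [m [k xz]]] rg; apply/asboolP; split; first by case.
  by exists m.+1, k => i; rewrite addnS /= xz.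
- move=> T Tz Tt Tc x Xx; have /asboolP[px [m [k xz]]] := Xx.
  (* T travels forward from z to a shift of z that is also a shift of x, then backward to x. *)
  have : T (shift x m).
    have -> : shift x m = shift z k by apply/funext.
    by elim: (k) => [|j IH]; rewrite ?shift0 ?shiftS //; apply: Tt => //; apply: Xshift.
  elim: (m) => [|j IH]; first by rewrite shift0.
  by rewrite shiftS => /(Tc _ (Xshift _ _ Xx)).
(* The offset m' makes the shift k + k (n - 1) = k n a multiple of the period, so x coincides with z
   from position m' on. *)
- move=> x /asboolP[px [m [k xz]]] sx; pose m' := (m + k * n.-1)%N.
  have xz' i : x (i + m')%N = z i.
    have -> : (i + m' = i + k * n.-1 + m)%N by rewrite /m'; lia.
    by rewrite xz -addnA -mulnSr prednK.
  have [cm sm] := @pchain_iota x 0 m' px; rewrite add0n in cm sm.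
  have sxm : s (x m') = w by rewrite -sz0 -(xz' 0%N).
  have xc i : x i \in c.
    have [lt_i|ge_i] := ltnP i m'; last by rewrite -(subnK ge_i) xz'.
    apply: (subc [seq x i | i <- iota 0 m']); last by rewrite map_f // mem_iota.
    rewrite /cycle_at -sxm cm sm sx sxm eqxx !andbT.
    by case: (m') lt_i.
  (* Edges of c are determined by their sources, so x and z agree step by step. *)
  apply/funext; elim=> [|i IH]; apply: inj => //; first by rewrite sx sz0.
  by rewrite -px -z_path IH.
- by split=> //; apply: map_uniq uc.
- by have /and3P[_ ? _] := cyc_c.
Qed.
End UniqueCycle.

(** * Action on delta functions of paths *)

Section CycleRepresentation.
Variables (K : fieldType) (E0 E1 : eqType) (r s : E1 -> E0) (L : nalgType K).
Variables (v : E0 -> nsort L) (e es : E1 -> nsort L).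
Hypothesis HL : is_leavitt_path_algebra r s v e es.
Variables (X : pred (nat -> E1)) (z : nat -> E1) (w : E0) (c : seq E1).
Hypothesis HX : path_class r s X z w c.

Definition pdelta (W : nmodType) (a : W) (q : nat -> E1) : (nat -> E1) -> W :=
  fun x => if x == q then a else 0.
Arguments pdelta {W} a q x /.

Section OneRepresentation.
Variables (W : lmodType K) (t ti : E1 -> W -> W).
Variable phi : nsort L -> ((nat -> E1) -> W) -> (nat -> E1) -> W.
Hypothesis Hphi : is_path_rep r s v e es X t ti phi.
Hypotheses (t0 : forall g, t g 0 = 0) (ti0 : forall g, ti g 0 = 0).

Lemma rep_lin y : linear (phi y). Proof. by case: Hphi. Qed.
Lemma rep0 y : phi y 0 = 0.
Proof. exact/linear_at0/rep_lin. Qed.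
Lemma repD a x y f : phi (a *: x + y) f = a *: phi x f + phi y f.
Proof. by case: Hphi. Qed.
Lemma rep_zero f : phi 0 f = 0.
Proof. by have := repD (-1) 0 0 f; rewrite scaler0 addr0 scaleN1r addNr. Qed.
Lemma repM x y f : phi (nmul x y) f = phi x (phi y f).
Proof. by case: Hphi. Qed.
Lemma rep_v u : phi (v u) = act_v s X u. Proof. by case: Hphi => _ _ _ []. Qed.
Lemma rep_e g : phi (e g) = act_e X t g. Proof. by case: Hphi => _ _ _ []. Qed.
Lemma rep_es g : phi (es g) = act_es r s X ti g. Proof. by case: Hphi => _ _ _ []. Qed.

Lemma rep_outside y f x : ~~ X x -> phi y f x = 0.
Proof.
move=> nX; move: y f; apply: (leavitt_ind HL).
- by split=> [|a y y' Sy Sy'] f; rewrite ?rep_zero // repD !fctE Sy Sy' scaler0 addr0.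
- by move=> y y' Sy _ f; rewrite repM.
- by move=> u f; rewrite rep_v /act_v (negPf nX).
- by move=> g f; rewrite rep_e /act_e (negPf nX).
- by move=> g f; rewrite rep_es /act_es (negPf nX).
Qed.

Lemma rep_local y f : (forall x, X x -> f x = 0) -> phi y f = 0.
Proof.
move: y f; apply: (leavitt_ind HL).
- by split=> [|a y y' Sy Sy'] f f0; rewrite ?rep_zero // repD Sy // Sy' // scaler0 addr0.
- by move=> y y' _ Sy' f f0; rewrite repM Sy' // rep0.
- move=> u f f0; apply/funext => x; rewrite rep_v /act_v.
  by case: ifP => // /andP[/f0].
- move=> g f f0; apply/funext => x; rewrite rep_e /act_e.
  by case: ifP => // /andP[/(class_tail HX)/f0 ->].
- move=> g f f0; apply/funext => x; rewrite rep_es /act_es.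
  case: ifP => // /andP[Xx /eqP sx]; rewrite f0 //.
  exact: (class_cons HX).
Qed.

(** One path suffices for each generator, and finiteness survives sums and composition. This reduces
    arbitrary functions to finite sums of deltas. *)
Lemma rep_finite y x : exists l : seq (nat -> E1),
  forall f, (forall p, p \in l -> f p = 0) -> phi y f x = 0.
Proof.
pose S y := forall x, exists l : seq (nat -> E1),
  forall f, (forall p, p \in l -> f p = 0) -> phi y f x = 0.
suff : S y by apply.
move: y; apply: (leavitt_ind HL) => [|y y' Sy Sy' {}x|u {}x|g {}x|g {}x].
- split=> [{}x|a y y' Sy Sy' {}x]; first by exists [::] => f _; rewrite rep_zero.
  have [[l hl] [l' hl']] := (Sy x, Sy' x); exists (l ++ l') => f fl.
  rewrite repD !fctE hl => [|p pl]; last by apply: fl; rewrite mem_cat pl.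
  rewrite hl' ?scaler0 ?addr0 // => p pl.
  by apply: fl; rewrite mem_cat pl orbT.
- have [l hl] := Sy x.
  have [l' hl'] : exists l' : seq (nat -> E1), forall p, p \in l ->
      forall f, (forall q, q \in l' -> f q = 0) -> phi y' f p = 0.
    elim: l {hl} => [|q l [l1 h1]]; first by exists [::].
    have [l2 h2] := Sy' q; exists (l1 ++ l2) => p; rewrite inE.
    by case/orP => [/eqP ->|pl] f hf; [apply: h2 | apply: (h1 p pl)] => q' ql;
      apply: hf; rewrite mem_cat ql ?orbT.
  by exists l' => f fl; rewrite repM; apply: hl => p pl; apply: (hl' p pl).
- by exists [:: x] => f f0; rewrite rep_v /act_v f0 ?mem_head // if_same.
- exists [:: stail x] => f f0; rewrite rep_e /act_e f0 ?mem_head // t0.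
  by rewrite if_same.
- exists [:: scons g x] => f f0; rewrite rep_es /act_es f0 ?mem_head // ti0.
  by rewrite if_same.
Qed.

(** By [rep_finite], f may be replaced by a finite sum of deltas without changing the value at x, so
    some delta gives a nonzero value; its path lies in X by [rep_local]. *)
Lemma rep_pdelta_neq0 y f x : phi y f x <> 0 ->
  exists q a, X q /\ phi y (pdelta a q) x <> 0.
Proof.
move=> nz; apply: contrapT => nex; apply: nz.
have all0 a q : phi y (pdelta a q) x = 0.
  have [Xq|nXq] := boolP (X q).
    by apply: contrapT => nq; apply: nex; exists q, a.
  rewrite rep_local // => p Xp /=; case: eqP Xp => // ->.
  by rewrite (negPf nXq).
have [l hl] := rep_finite y x.
pose g := \sum_(q <- undup l) pdelta (f q) q.
have rep_sum : phi y g x = 0.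
  rewrite /g; elim: (undup l) => [|q l' IH]; first by rewrite big_nil rep0.
  rewrite big_cons -[pdelta _ _]scale1r rep_lin !fctE IH addr0 scale1r.
  exact: all0.
have : phi y ((-1) *: g + f) x = 0.
  apply: hl => p pl; rewrite !fctE /g fct_sumE /=.
  rewrite (bigD1_seq p) ?mem_undup ?undup_uniq //= eqxx big1.
    by rewrite addr0 scaleN1r addNr.
  by move=> q; rewrite eq_sym => /negPf ->.
by rewrite rep_lin !fctE rep_sum scaler0 add0r.
Qed.

(** Only z starts at w in X, so w acts as the projection onto the value at z. *)
Lemma rep_w f : phi (v w) f = pdelta (f z) z.
Proof.
apply/funext => x; rewrite rep_v /act_v /=; have [->|nx] := eqVneq x z.
  by rewrite (class_base HX) (class_source HX) eqxx.
case: ifP => // /andP[Xx /eqP sx]; case/eqP: nx; exact: (class_unique HX).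
Qed.

Definition sapp (l : seq E1) (x : nat -> E1) := foldr (@scons E1) x l.

Lemma sapp_source l : s (sapp l z 0%N) = psrc s l w.
Proof. by case: l => //=; rewrite (class_source HX). Qed.

Lemma sapp_class l : pchain r s l w -> X (sapp l z).
Proof.
elim: l => [_|g l IH] /=; first exact: (class_base HX).
by case/andP => /eqP rg /IH Xl; apply: (class_cons HX); rewrite ?sapp_source.
Qed.

Lemma act_e_pdelta g a q : X (scons g q) ->
  act_e X t g (pdelta a q) = pdelta (t g a) (scons g q).
Proof.
move=> Xq; apply/funext => x; rewrite /act_e /=; have [->|/eqP nx] := eqVneq x (scons g q).
  by rewrite Xq /= !eqxx.
case: ifP => // /andP[_ /eqP xg]; case: eqP => [xq|_]; last exact: t0.
by case: nx; rewrite -xq -xg scons_stail.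
Qed.

Lemma rep_pe l f : pchain r s l w ->
  phi (pe v e l w) f = pdelta (foldr t (f z) l) (sapp l z).
Proof.
elim: l => [_|g l IH cgl] /=; first exact: rep_w.
have /andP[_ cl] := cgl.
rewrite repM IH // rep_e act_e_pdelta //.
exact: (sapp_class cgl).
Qed.

(** Prefixing c to z gives a member of X starting at w, that is z again; only the weights along c
    remain. *)
Lemma rep_cycle f : phi (pe v e c w) f = pdelta (foldr t (f z) c) z.
Proof.
rewrite rep_pe ?(class_chain HX) //; congr pdelta; apply: (class_unique HX).
  exact/sapp_class/(class_chain HX).
by rewrite sapp_source (class_psrc HX).
Qed.

Definition rep_ker y := forall f, phi y f = 0.

Lemma rep_ker_ideal : LPideal rep_ker.
Proof.
split=> [f|x y Px Py f|x Px f|a x Px f|a x Px f].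
- exact: rep_zero.
- by rewrite -[x]scale1r repD Px Py scaler0 addr0.
- by rewrite -[- x]addr0 -scaleN1r repD Px rep_zero scaler0 addr0.
- by rewrite repM Px rep0.
- by rewrite repM Px.
Qed.

End OneRepresentation.

Section Intertwiner.
Variables (W W' : lmodType K) (t ti : E1 -> W -> W) (t' ti' : E1 -> W' -> W').
Variable phi : nsort L -> ((nat -> E1) -> W) -> (nat -> E1) -> W.
Variable phi' : nsort L -> ((nat -> E1) -> W') -> (nat -> E1) -> W'.
Hypothesis Hphi : is_path_rep r s v e es X t ti phi.
Hypothesis Hphi' : is_path_rep r s v e es X t' ti' phi'.
Variable h : W -> W'.
Hypothesis hlin : linear h.
Hypotheses (ht : forall g a, h (t g a) = t' g (h a)).
Hypotheses (hti : forall g a, h (ti g a) = ti' g (h a)).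

(** The identity need only be checked on generators; it serves to compare the module over the dual
    numbers with the scalar one. *)
Lemma rep_intertwine y f : h \o phi y f = phi' y (h \o f).
Proof.
have h0 := linear_at0 hlin.
move: y f; apply: (leavitt_ind HL).
- split=> [|a y y' Sy Sy'] f; apply/funext => x /=.
    by rewrite (rep_zero Hphi) (rep_zero Hphi') h0.
  by rewrite (repD Hphi) (repD Hphi') !fctE hlin -Sy -Sy'.
- by move=> y y' Sy Sy' f; rewrite (repM Hphi) (repM Hphi') Sy Sy'.
- move=> u f; apply/funext => x /=; rewrite (rep_v Hphi) (rep_v Hphi') /act_v.
  by case: ifP.
- move=> g f; apply/funext => x /=; rewrite (rep_e Hphi) (rep_e Hphi') /act_e.
  by case: ifP; rewrite ?ht.
- move=> g f; apply/funext => x /=; rewrite (rep_es Hphi) (rep_es Hphi') /act_es.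
  by case: ifP; rewrite ?hti.
Qed.
End Intertwiner.
End CycleRepresentation.

(** * Kernels *)

Section PrimeKernel.
Variables (K : fieldType) (E0 E1 : eqType) (r s : E1 -> E0) (L : nalgType K).
Variables (v : E0 -> nsort L) (e es : E1 -> nsort L).
Hypothesis HL : is_leavitt_path_algebra r s v e es.
Variables (X : pred (nat -> E1)) (z : nat -> E1) (w : E0) (c : seq E1).
Hypothesis HX : path_class r s X z w c.

Section Scalar.
Variable phi : nsort L -> ((nat -> E1) -> K^o) -> (nat -> E1) -> K^o.
Hypothesis Hphi : is_path_rep r s v e es X (fun _ => id) (fun _ => id) phi.
Let idt0 (g : E1) : (fun _ : E1 => @id K^o) g 0 = 0. Proof. by []. Qed.

(** The vertex w is the unit for p = q = z; edges and ghost edges then move p and q through the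
    whole class by [class_ind]. *)
Lemma matrix_unit p q : X p -> X q ->
  exists y, forall f, phi y f = pdelta (f p) q.
Proof.
move=> Xp Xq; move: p Xp q Xq; apply: (class_ind HX) => [|p Xp Sp q Xq|p Xp Sp q Xq].
- apply: (class_ind HX) => [|q Xq [y hy]|q Xq [y hy]].
  + by exists (v w) => f; apply: (rep_w HX Hphi).
  + exists (nmul (es (q 0%N)) y) => f; rewrite (repM Hphi) hy (rep_es Hphi).
    apply/funext => x; rewrite /act_es /pdelta; have [->|nx] := eqVneq x (stail q).
      rewrite (class_tail HX) // scons_stail eqxx /stail (class_path HX Xq).
      by rewrite eqxx.
    case: ifP => // _; case: eqP => // eq; case/eqP: nx.
    by rewrite -eq.
  + exists (nmul (e (q 0%N)) y) => f; rewrite (repM Hphi) hy (rep_e Hphi).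
    by rewrite (act_e_pdelta idt0) scons_stail.
- have [y hy] := Sp q Xq; exists (nmul y (e (p 0%N))) => f.
  by rewrite (repM Hphi) hy (rep_e Hphi) /act_e Xp eqxx.
- have [y hy] := Sp q Xq; exists (nmul y (es (p 0%N))) => f.
  rewrite (repM Hphi) hy (rep_es Hphi) /act_es (class_tail HX) // scons_stail.
  by rewrite /stail (class_path HX Xp) eqxx.
Qed.

(** If y in I and y' in J act nontrivially, a suitable matrix unit u makes y u y' act nontrivially,
    yet it lies in I J. *)
Lemma rep_ker_prime : LPprime (rep_ker phi).
Proof.
split; first exact: (rep_ker_ideal Hphi).
  exists (v w) => /(_ (fun _ => 1)) /(congr1 (@^~ z)).
  by rewrite (rep_w HX Hphi) /pdelta eqxx => /eqP; rewrite oner_eq0.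
move=> I J idI idJ IJ; apply: contrapT => /not_orP[nI nJ].
have nonzero (A : nsort L -> Prop) : ~ LPsub A (rep_ker phi) ->
    exists y f x, A y /\ phi y f x <> 0.
  move=> nA; apply: contrapT => nex; apply: nA => y Ay f; apply/funext => x.
  by apply: contrapT => nz; apply: nex; exists y, f, x.
have [y [f [x [Iy /(rep_pdelta_neq0 HL HX Hphi idt0 idt0)]]]] := nonzero I nI.
move=> [q [a [Xq nz]]]; have [y' [f' [p [Jy' nz']]]] := nonzero J nJ.
have Xp : X p.
  by apply: contraT => nX; case: nz'; apply: (rep_outside HL Hphi).
have [u hu] := matrix_unit Xp Xq.
have : LPprod I J (nmul (nmul y u) y').
  exists [:: (nmul y u, y')]; rewrite big_seq1; split=> // _ [<-|[]] //.
  by split=> //; case: idI => _ _ _ _; apply.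
move/IJ => /(_ f') /(congr1 (@^~ x)); rewrite !(repM Hphi) hu.
have a0 : a != 0.
  apply/eqP => a0; apply: nz; rewrite a0.
  have -> : pdelta (0 : K^o) q = 0 by apply/funext => ?; rewrite /pdelta if_same.
  by rewrite (rep0 Hphi).
(* Values lie in K, so any delta at q is a scalar multiple of the one that y does not kill. *)
have -> : pdelta (phi y' f' p) q = (phi y' f' p / a) *: pdelta a q.
  apply/funext => x'; rewrite /pdelta !fctE; case: eqP => _; last by rewrite scaler0.
  by rewrite /GRing.scale /= divfK.
rewrite -[_ *: _]addr0 (rep_lin Hphi) (rep0 Hphi) addr0 !fctE /GRing.scale /=.
by apply/eqP; rewrite !mulf_neq0 ?invr_neq0 //; apply/eqP.
Qed.

Lemma cycle_sub_in_ker : rep_ker phi (pe v e c w - v w).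
Proof.
move=> f; rewrite -scaleN1r addrC (repD Hphi) (rep_cycle HX Hphi idt0) (rep_w HX Hphi).
have -> : foldr (fun=> id) (f z) c = f z by elim: (c).
by rewrite scaleN1r addNr.
Qed.
End Scalar.

(** The pair (a, b) stands for a + b eps; the edge f acts as multiplication by 1 + eps, every other
    edge trivially. *)
Definition shear (f g : E1) (a : K^o * K^o) : K^o * K^o :=
  if g == f then (a.1, a.2 + a.1) else a.
Definition unshear (f g : E1) (a : K^o * K^o) : K^o * K^o :=
  if g == f then (a.1, a.2 - a.1) else a.

(* The kernel of the representation over the dual numbers in which the first
   edge of c carries the weight 1 + eps. *)
Lemma dual_kernel : exists P Q : nsort L -> Prop, exists d,
  [/\ LPprime P, LPideal Q, P d, ~ Q d & forall x y, P x -> P y -> Q (nmul x y)].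
Proof.
have [phi1 H1] := @path_rep_ex K E0 E1 r s L v e es HL X (class_path HX) (class_tail HX)
  (class_cons HX) K^o (fun _ => id) (fun _ => id) (fun _ _ _ _ => erefl)
  (fun _ _ _ _ => erefl) (fun _ _ => erefl) (fun _ _ => erefl).
have [c0 uc] := class_cycle HX; case ec: c c0 uc => [//|f c'] _ /= /andP[fc' _].
have [||||phi2 H2] := @path_rep_ex K E0 E1 r s L v e es HL X (class_path HX)
  (class_tail HX) (class_cons HX) (K^o * K^o)%type (shear f) (unshear f).
- move=> g a x y; rewrite /shear; case: ifP => // _.
  by congr pair => /=; rewrite scalerDr addrACA.
- move=> g a x y; rewrite /unshear; case: ifP => // _.
  by congr pair => /=; rewrite scalerBr opprD addrACA.
- by move=> g [a b]; rewrite /shear /unshear; case: eqP => //= _; rewrite addrK.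
- by move=> g [a b]; rewrite /shear /unshear; case: eqP => //= _; rewrite subrK.
exists (rep_ker phi1), (rep_ker phi2), (pe v e c w - v w); split.
- exact: rep_ker_prime.
- exact: (rep_ker_ideal H2).
- exact: cycle_sub_in_ker.
- have shear0 g : shear f g 0 = 0.
    by rewrite /shear; case: ifP => // _ /=; rewrite addr0.
  move=> /(_ (fun _ => (1, 0))) /(congr1 (@^~ z)).
  rewrite -scaleN1r addrC (repD H2) (rep_cycle HX H2 shear0) (rep_w HX H2) ec /=.
  (* The edge f occurs only once in c, so the weight of c is exactly 1 + eps, in every
     characteristic. *)
  have -> : foldr (shear f) (1, 0) c' = (1, 0).
    elim: c' fc' {ec} => //= g l IH; rewrite inE negb_or => /andP[fg /IH ->].
    by rewrite /shear eq_sym (negPf fg).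
  rewrite /shear eqxx !fctE /pdelta eqxx scaleN1r => /(congr1 snd) /= /eqP.
  by rewrite oppr0 !add0r oner_eq0.
- move=> x y Px Py g; rewrite (repM H2).
  (* Reduction modulo eps is an intertwiner, so y in P maps everything into multiples of eps. These
     form a copy of the scalar module through [i2], and x in P kills it. *)
  have fstE := rep_intertwine HL H2 H1 (h := fst) (fun _ _ _ => erefl) _ _ y g.
  have {}fstE : fst \o phi2 y g = 0.
    rewrite fstE ?Py //; first by move=> g' [a b]; rewrite /shear; case: ifP.
    by move=> g' [a b]; rewrite /unshear; case: ifP.
  pose i2 (a : K^o) : K^o * K^o := (0, a).
  have -> : phi2 y g = i2 \o (snd \o phi2 y g).
    apply/funext => p /=; have := congr1 (@^~ p) fstE => /=.
    by rewrite /i2; case: (phi2 y g p) => a b /= ->.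
  rewrite -(rep_intertwine HL H1 H2 (h := i2)).
  + by rewrite Px; apply/funext.
  + by move=> a b b'; rewrite /i2; congr pair => /=; rewrite scaler0 addr0.
  + by move=> g' a; rewrite /shear /i2; case: ifP => //= _; rewrite addr0.
  + by move=> g' a; rewrite /unshear /i2; case: ifP => //= _; rewrite subr0.
Qed.
Lemma nongraded_kernel : exists P : nsort L -> Prop, LPideal P /\ ~ LPgraded v e es P.
Proof.
have [phi1 H1] := @path_rep_ex K E0 E1 r s L v e es HL X (class_path HX) (class_tail HX)
  (class_cons HX) K^o (fun _ => id) (fun _ => id) (fun _ _ _ _ => erefl)
  (fun _ _ _ _ => erefl) (fun _ _ => erefl) (fun _ _ => erefl).
pose T (_ : E1) (a : int -> K^o) : int -> K^o := fun k => a (k - 1).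
pose T' (_ : E1) (a : int -> K^o) : int -> K^o := fun k => a (k + 1).
have TK g : cancel (T g) (T' g) by move=> a; apply/funext => k; rewrite /T /T' addrK.
have T'K g : cancel (T' g) (T g) by move=> a; apply/funext => k; rewrite /T /T' subrK.
have [phi2 H2] := @path_rep_ex K E0 E1 r s L v e es HL X (class_path HX)
  (class_tail HX) (class_cons HX) (int -> K^o) T T' (fun _ _ _ _ => erefl)
  (fun _ _ _ _ => erefl) TK T'K.
(* y acts on the second module as on the first one, with a shift by n *)
pose shifts (n : int) y := forall f x k, phi2 y f x k = phi1 y (fun p => f p (k - n)) x.
have shifts_gen g : shifts (gdeg g) (gval v e es g).
  case: g => [u|g|g] f x k /=.
  - by rewrite (rep_v H1) (rep_v H2) /act_v subr0; case: ifP.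
  - by rewrite (rep_e H1) (rep_e H2) /act_e; case: ifP.
  - by rewrite (rep_es H1) (rep_es H2) /act_es opprK; case: ifP.
have shifts_word gw : shifts (wdeg gw) (weval v e es gw).
  case: gw => g l; elim/last_ind: l => [|l h IH].
    by rewrite /wdeg /weval big_nil addr0; apply: shifts_gen.
  have -> : wdeg (g, rcons l h) = wdeg (g, l) + gdeg h.
    by rewrite /wdeg /= -cats1 big_cat big_seq1 addrA.
  rewrite /weval /= foldl_rcons -/(weval v e es (g, l)) => f x k.
  rewrite (repM H1) (repM H2) IH; congr (phi1 _ _ x); apply/funext => p.
  by rewrite shifts_gen (opprD (wdeg (g, l))) addrA.
have shifts_homog n y : LPhomog v e es n y -> shifts n y.
  move=> [l [dl ->]] f x k; elim: l dl => [|q l IH] dl.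
    by rewrite big_nil (rep_zero H1) (rep_zero H2).
  rewrite big_cons (repD H1) (repD H2) !fctE IH; last by move=> p ?; apply: dl; right.
  by rewrite shifts_word (dl q (or_introl erefl)).
exists (rep_ker phi1); split; first exact: (rep_ker_ideal H1).
move=> /(_ _ (cycle_sub_in_ker H1)) [l [dl ed]].
(* On the second module a homogeneous element acts as on the first up to a translation, so each
   homogeneous summand lying in P kills it. *)
have d0 : rep_ker phi2 (pe v e c w - v w).
  rewrite ed; elim: l dl {ed} => [|q l IH] dl f; first by rewrite big_nil (rep_zero H2).
  rewrite big_cons -[q.2]scale1r (repD H2) IH; last by move=> p ?; apply: dl; right.
  have [Pq /shifts_homog hq] := dl q (or_introl erefl).
  by rewrite scale1r addr0; apply/funext => x; apply/funext => k; rewrite hq Pq.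
pose f0 : (nat -> E1) -> int -> K^o := fun _ k => if k == 0 then 1 else 0.
have := congr1 (fun h => h z 0) (d0 f0).
have T0 g : T g 0 = 0 by [].
rewrite -scaleN1r addrC (repD H2) (rep_cycle HX H2 T0) (rep_w HX H2) !fctE /pdelta eqxx.
(* The cycle translates by its positive length, so at index 0 only the contribution -1 of w is
   left. *)
have -> : foldr T (f0 z) c = fun k => f0 z (k - (size c)%:Z).
  elim: (c) => [|g l' IH] /=; first by apply/funext => k; rewrite subr0.
  by rewrite IH; apply/funext => k; rewrite /T -addrA -opprD -intS.
have [c0 _] := class_cycle HX; rewrite /f0 sub0r oppr_eq0 eqxx.
case: (c) c0 => //= _ _ _; rewrite addr0 scaleN1r => /eqP.
by rewrite oppr_eq0 oner_eq0.
Qed.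
End PrimeKernel.

(** * Equivalence of the four conditions *)

Theorem theorem5p4 (K : fieldType) (E0 E1 : Type) (hE0 : inhabited E0)
  (r s : E1 -> E0) (L : nalgType K)
  (v : E0 -> nsort L) (e es : E1 -> nsort L) :
  is_leavitt_path_algebra r s v e es ->
  let c1 := forall I : nsort L -> Prop,
              LPideal I -> LPproper I -> LPsemiprime I in
  let c2 := forall I : nsort L -> Prop, LPideal I -> LPgraded v e es I in
  let c3 := forall (P1 : nsort L -> Prop) (ps : seq (nsort L -> Prop)),
              LPprime P1 -> (forall P, List.In P ps -> LPprime P) ->
              LPeq (LPprod_list P1 ps) (LPcap_list P1 ps) in
  let c4 := LPcondition_K r s in
  [/\ c1 <-> c4, c2 <-> c4 & c3 <-> c4].
Proof.
move=> HL c1 c2 c3 c4.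
(* [{classic E0}] and [{classic E1}] carry the classical decidable equality that the preceding
   results ask of vertices and edges. *)
have idem : c4 -> forall I : nsort L -> Prop, LPideal I -> LPsub I (LPprod I I).
  by move=> HK I; apply: (@condition_K_idem K {classic E0} {classic E1} r s L v e es HL HK).
have cycle : ~ c4 -> exists X z w c, @path_class {classic E0} {classic E1} r s X z w c.
  exact: (@not_K_path_class {classic E0} {classic E1} r s).
have dual : ~ c4 -> exists P Q : nsort L -> Prop,
    [/\ LPprime P, LPideal Q, ~ LPsub P Q & LPsub (LPprod P P) Q].
  move=> /cycle [X [z [w [c HX]]]].
  have [P [Q [d [primeP idQ Pd nQd PPQ]]]] := dual_kernel (HL : is_leavitt_path_algebra
    (E0 := {classic E0}) (E1 := {classic E1}) r s v e es) HX.
  exists P, Q; split=> // [PQ|x [l [dl ->]]]; first exact/nQd/PQ.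
  case: idQ => Q0 QD _ _ _; elim: l dl => [|p l IH] dl; first by rewrite big_nil.
  rewrite big_cons; apply: QD; last by apply: IH => q ?; apply: dl; right.
  by have [] := dl p (or_introl erefl); apply: PPQ.
split; split.
- move=> h; apply: contrapT => /dual [P [Q [[idP _ _] idQ nPQ PPQ]]].
  have [_ _ spQ] : LPsemiprime Q.
    (* Q is proper, since otherwise it would contain P. *)
    apply: h => //; apply: contrapT => nQ; apply: nPQ => x _.
    by apply: contrapT => nx; apply: nQ; exists x.
  exact/nPQ/spQ.
- move=> HK I idI pI; split=> // J idJ JJ x Jx.
  exact/JJ/idem.
- move=> h; apply: contrapT => /cycle [X [z [w [c HX]]]].
  have [P [idP]] := nongraded_kernel (HL : is_leavitt_path_algebra
    (E0 := {classic E0}) (E1 := {classic E1}) r s v e es) HX.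
  by apply; apply: h.
- move=> HK I.
  exact: (@condition_K_graded K {classic E0} {classic E1} r s L v e es HL HK).
- move=> h; apply: contrapT => /dual [P [Q [primeP _ nPQ PPQ]]].
  apply: nPQ => x Px; apply: PPQ.
  (* For the list P, P condition (3) says that P P = P, which puts P inside Q. *)
  apply/(h P [:: P] primeP _ x); last by move=> R [<-|[<-|[]]].
  by move=> R [<-|[]].
- move=> HK P ps [idP _ _] primes x.
  by apply: (LPprod_list_idem (idem HK)) => // R /primes[].
Qed.
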